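(* Let $M=\mathbb{R}/\mathbb{Z}$ be the circle and let $f_0:M\to M$ be a $C^2$ local diffeomorphism having a unique saddle-node fixed point, denoted $0$, i.e. $f_0(0)=0$, $f_0'(0)=1$ and $f_0''(0)>0$. Let $W_0$ be the connected component containing $0$ of the basin $B(\{0\})=\{x\in M: f_0^k(x)\to 0 \text{ as } k\to\infty\}$, and assume $|f_0'(x)|>1$ for all $x\in M\setminus W_0$. Then every $f_0$-invariant Borel probability measure $\mu$ satisfying the Entropy Formula $h_\mu(f_0)=\int\log|f_0'|\,d\mu$ coincides with the Dirac mass $\delta_0$ at $0$.
   Context: $h_\mu(f_0)$ denotes the Kolmogorov–Sinai metric entropy of $f_0$ with respect to $\mu$. *)

(* Defs.v *)
From HB Require Import structures.
From mathcomp Require Import all_boot all_order all_algebra.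
From mathcomp Require Import all_classical all_reals all_analysis.
Set Implicit Arguments.
Unset Strict Implicit.
Unset Printing Implicit Defensive.
Import Order.TTheory GRing.Theory Num.Theory.
Import numFieldNormedType.Exports.
Local Open Scope classical_set_scope.
Local Open Scope ring_scope.

Section KSEntropy.
Context d (T : measurableType d) (R : realType).

Definition is_fin_meas_partition (k : nat) (P : 'I_k -> set T) : Prop :=
  [/\ forall i, measurable (P i),
      forall i j, i != j -> P i `&` P j = set0 &
      forall x, exists i, P i x].

Definition ent_phi (t : R) : R := if t == 0 then 0 else - (t * ln t).

(* cell of the join  P v g^-1 P v ... v g^-(n-1) P  with itinerary s *)
Definition join_cell (g : T -> T) (k n : nat) (P : 'I_k -> set T)
    (s : 'I_n -> 'I_k) : set T :=
  [set x | forall i : 'I_n, P (s i) (iter i g x)].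

Definition join_entropy (mu : set T -> \bar R) (g : T -> T) (k : nat)
    (P : 'I_k -> set T) (n : nat) : R :=
  \sum_(s : {ffun 'I_n -> 'I_k}) ent_phi (fine (mu (join_cell g P s))).

Definition part_entropy (mu : set T -> \bar R) (g : T -> T) (k : nat)
    (P : 'I_k -> set T) : R :=
  lim ((fun n : nat => (join_entropy mu g P n.+1 / n.+1%:R : R)) @ \oo).

Definition KS_entropy (mu : set T -> \bar R) (g : T -> T) : \bar R :=
  ereal_sup [set e | exists (k : nat) (P : 'I_k -> set T),
                       is_fin_meas_partition P /\ e = (part_entropy mu g P)%:E].
End KSEntropy.

(* The circle M = R/Z, represented by fundamental domain [0,1) in R.  *)
(* A circle map is given by a lift F : R -> R with F(x+1) = F x + deg. *)
Section Circle.
Context (R : realType).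

Definition frac1 (x : R) : R := x - (Num.floor x)%:~R.

Definition circle_map (F : R -> R) (x : R) : R := frac1 (F x).

Definition circ_dist0 (y : R) : R := Num.min (frac1 y) (1 - frac1 y).

(* preimage in R of the basin B({0}) = {x | f0^k(x) -> 0} *)
Definition basin0_lift (F : R -> R) : set R :=
  [set x | (fun k : nat => circ_dist0 (iter k (circle_map F) x)) @ \oo --> (0 : R)].

(* preimage in R of W0, the connected component of B({0}) containing 0 *)
Definition W0_lift (F : R -> R) : set R :=
  \bigcup_(n in [set: int]) ((fun x => x + n%:~R) @^-1`
      connected_component (basin0_lift F) 0).
End Circle.

(* Main.v *)
Require Import Defs.
From HB Require Import structures.
From mathcomp Require Import all_boot all_order all_algebra.
From mathcomp Require Import all_classical all_reals all_analysis.
From mathcomp Require Import measurable_realfun ring lra.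
Set Implicit Arguments.
Unset Strict Implicit.
Unset Printing Implicit Defensive.
Import Order.TTheory GRing.Theory Num.Theory.
Import numFieldNormedType.Exports.
Local Open Scope classical_set_scope.
Local Open Scope ring_scope.

(* Normalise the lift so that [F 0 = 0] and let [p] be the largest fixed point of
   [F] in [-1, 0).  Points of (p, 0) move right towards [0], so an invariant
   measure gives no mass to (p + 1, 1).  If [p = -1] only the Dirac mass is left.
   Otherwise put [a = p + 1]; the immediate basin of [0] is (p, 0], hence
   [F' > 1] on (0, a], and the measure is carried by the points whose orbit stays
   in [0, a].  These are coded by words in the [deg F] inverse branches, each of
   which maps [0, a] into itself, the branch of digit 0 being neutral at [0].

   Between the images of the branches there are holes.  Bounded distortion away
   from the neutral point gives [eta > 0] such that, for each [n], the lengths of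
   the cells of order [n], each weighted by [(1 + eta) ^ #(nonzero digits)], add
   up to at most [a].  Since minus the logarithm of the length of a cell is, up to
   [o(n)], the Birkhoff sum of [ln F'], Gibbs' inequality yields
     h_mu <= int ln F' dmu - ln (1 + eta) * mu (first digit nonzero).
   The entropy formula thus forces the first digit, hence by invariance all
   digits, to vanish almost surely, and the only such point is [0]. *)

(** * Integrals of bounded functions and invariant measures *)

Section BoundedIntegral.
Context d (T : measurableType d) (R : realType) (mu : probability T R).

Definition bounded_measurable (g : T -> R) :=
  measurable_fun setT g /\ exists M, forall x, `|g x| <= M.
Local Notation bm := bounded_measurable.

Lemma bounded_measurable_integrable g : bm g -> mu.-integrable setT (EFin \o g).
Proof.
move=> [mg [M gM]]; apply: measurable_bounded_integrable => //.
  by rewrite (le_lt_trans (probability_le1 _ _)) ?ltry.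
by exists M; split=> [|y My x _]; [exact: num_real|exact: le_trans (gM x) (ltW My)].
Qed.

Lemma bounded_measurable_cst r : bm (cst r).
Proof. by split; [exact: measurable_cst|exists `|r|]. Qed.

Lemma bounded_measurableD g h : bm g -> bm h -> bm (fun x => g x + h x).
Proof.
move=> [mg [M gM]] [mh [N hN]]; split; first exact: measurable_funD.
by exists (M + N) => x; apply: (le_trans (ler_normD _ _)); exact: lerD.
Qed.

Lemma bounded_measurableZ r g : bm g -> bm (fun x => r * g x).
Proof.
move=> [mg [M gM]]; split; first exact: measurable_funM.
by exists (`|r| * M) => x; rewrite normrM ler_wpM2l.
Qed.

Lemma bounded_measurable_indic A : measurable A -> bm (\1_A : T -> R).
Proof.
move=> mA; split; first exact: measurable_indic.
by exists 1 => x; rewrite indicE; case: (_ \in _); rewrite ?normr1 ?normr0 ?ler01.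
Qed.

Lemma bounded_measurable_sum (I : Type) (s : seq I) (g : I -> T -> R) :
  (forall i, bm (g i)) -> bm (fun x => \sum_(i <- s) g i x).
Proof.
move=> bg; elim: s => [|i s IH].
  by under eq_fun do rewrite big_nil; exact: bounded_measurable_cst.
by under eq_fun do rewrite big_cons; exact: bounded_measurableD.
Qed.

Lemma bounded_measurable_comp (f : T -> T) g :
  measurable_fun setT f -> bm g -> bm (fun x => g (f x)).
Proof.
by move=> mf [mg [M gM]]; split; [exact: measurableT_comp|exists M => x].
Qed.

Lemma Rintegral_sum (I : Type) (s : seq I) (g : I -> T -> R) :
  (forall i, bm (g i)) ->
  \int[mu]_x (\sum_(i <- s) g i x) = \sum_(i <- s) \int[mu]_x g i x.
Proof.
move=> bg; elim: s => [|i s IH].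
  rewrite big_nil; under eq_Rintegral do rewrite big_nil.
  by rewrite Rintegral_cst // mul0r.
rewrite big_cons; under eq_Rintegral do rewrite big_cons.
rewrite RintegralD ?IH //; apply: bounded_measurable_integrable => //.
exact: bounded_measurable_sum.
Qed.

Lemma Rintegral_indic A : measurable A -> \int[mu]_x \1_A x = fine (mu A).
Proof. by move=> mA; rewrite /Rintegral integral_indic // setIT. Qed.

Lemma Rintegral_prob_cst r : \int[mu]_x r = r.
Proof.
rewrite Rintegral_cst //; transitivity (r * fine (1 : \bar R)%E).
  by congr (_ * fine _); exact: probability_setT.
by rewrite mulr1.
Qed.

Lemma Rintegral_invariant (f : T -> T) g : measurable_fun setT f ->
  (forall A, measurable A -> mu (f @^-1` A) = mu A) ->
  bm g -> \int[mu]_x g (f x) = \int[mu]_x g x.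
Proof.
move=> mf inv bg; rewrite /Rintegral; congr fine.
have := @integral_pushforward _ _ T T R f mf mu setT (EFin \o g).
rewrite preimage_setT => <- //.
- apply: eq_measure_integral => A mA _; exact: inv.
- by apply/measurable_EFinP; case: bg.
- exact/bounded_measurable_integrable/bounded_measurable_comp.
Qed.

(** Adding a multiple of the indicator of the null complement of [K] to [h] keeps its integral and
    makes the inequality hold everywhere; the multiple [M + N] dominates [g - h]. *)
Lemma Rintegral_le_full K g h : measurable K -> mu K = 1%E -> bm g -> bm h ->
  (forall x, K x -> g x <= h x) -> \int[mu]_x g x <= \int[mu]_x h x.
Proof.
move=> mK K1 bg bh gh.
have [[_ [M gM]] [_ [N hN]]] := (bg, bh).
have bK : bm (\1_(~` K) : T -> R) by apply/bounded_measurable_indic/measurableC.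
have K0 : \int[mu]_x (\1_(~` K) x : R) = 0.
  rewrite Rintegral_indic; last exact: measurableC.
  by rewrite probability_setC // K1 subee.
have -> : \int[mu]_x h x = \int[mu]_x (h x + (M + N) * \1_(~` K) x).
  rewrite RintegralD //; try exact: bounded_measurable_integrable.
    rewrite RintegralZl ?K0 ?mulr0 ?addr0 //.
    exact: bounded_measurable_integrable.
  exact/bounded_measurable_integrable/bounded_measurableZ.
apply: le_Rintegral => //; first exact: bounded_measurable_integrable.
  exact/bounded_measurable_integrable/bounded_measurableD/bounded_measurableZ.
move=> x _; rewrite indicE in_setC; case: (boolP (x \in K)) => [/set_mem Kx|_].
  by rewrite /= mulr0 addr0 gh.
rewrite /= mulr1; have := gM x; have := hN x; rewrite !ler_norml; lra.
Qed.

End BoundedIntegral.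

(** * Measurability of circle maps and of integer parts *)

Section CircleMap.
Context (R : realType).

Lemma frac1_id (x : R) : 0 <= x < 1 -> frac1 x = x.
Proof.
by move=> xin; rewrite /frac1 (@floor_def _ x 0) ?subr0 // add0r.
Qed.

Lemma frac1Dz (x : R) (m : int) : frac1 (x + m%:~R) = frac1 x.
Proof. by rewrite /frac1 floorDrz ?intr_int // intrKfloor intrD; ring. Qed.

Lemma measurable_frac1 : measurable_fun setT (@frac1 R).
Proof.
apply: measurable_funB; first exact: measurable_id.
apply: nondecreasing_measurable => // x y xy.
by rewrite ler_int floor_ge_int (le_trans (floor_le x)).
Qed.

Lemma measurable_circle_map (F : R -> R) :
  continuous F -> measurable_fun setT (circle_map F).
Proof.
move=> Fc; apply: (measurableT_comp measurable_frac1).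
exact: continuous_measurable_fun.
Qed.

Lemma measurable_truncn (j : nat) : measurable [set y : R | Num.truncn y = j].
Proof.
case: j => [|j].
  (* [Num.truncn] sends every negative number to 0, so the fibre of 0 is a half-line. *)
  rewrite (_ : [set _ | _] = `]-oo, 1[%classic) //.
  apply/seteqP; split=> y /=; rewrite in_itv /=; first by move/truncn0Pn; rewrite -ltNge.
  by move=> y1; apply/truncn0Pn; rewrite -ltNge.
rewrite (_ : [set _ | _] = `[j.+1%:R, j.+2%:R[%classic) //.
apply/seteqP; split=> y /=; rewrite in_itv /=; last exact: truncn_def.
move=> yj; have y0 : 0 <= y.
  by rewrite leNgt; apply/negP => y0; move: yj; rewrite truncn_floor leNgt y0.
by rewrite -truncn_eq // yj.
Qed.

End CircleMap.

(** * Null and full sets of an invariant measure *)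

Section Invariance.
Context d (T : measurableType d) (R : realType) (mu : probability T R) (f : T -> T).
Hypothesis mf : measurable_fun setT f.
Hypothesis invf : forall A, measurable A -> mu (f @^-1` A) = mu A.

Lemma measurable_iterate n : measurable_fun setT (iter n f).
Proof.
elim: n => [|n IH]; first exact: measurable_id.
exact: (measurableT_comp mf IH).
Qed.

Lemma measurable_iterate_preimage n A :
  measurable A -> measurable (iter n f @^-1` A).
Proof.
by move=> mA; rewrite -[X in measurable X]setTI; exact: measurable_iterate.
Qed.

Lemma iterate_invariant n A : measurable A -> mu (iter n f @^-1` A) = mu A.
Proof.
elim: n => [//|n IH] mA; rewrite -[RHS]IH // -[RHS]invf.
  by congr (mu _); apply/seteqP; split=> x /=; rewrite -iterS iterSr.
exact: measurable_iterate_preimage.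
Qed.

Lemma iterates_null N : measurable N -> mu N = 0%E ->
  mu (\bigcup_n (iter n f @^-1` N)) = 0%E.
Proof.
move=> mN N0.
have mU : measurable (\bigcup_n (iter n f @^-1` N)).
  by apply: bigcupT_measurable => n; exact: measurable_iterate_preimage.
have : mu.-negligible (\bigcup_n (iter n f @^-1` N)).
  apply: negligible_bigcup => n; exists (iter n f @^-1` N); split=> //.
    exact: measurable_iterate_preimage.
  by have := iterate_invariant n mN; rewrite N0.
by move=> /(negligibleP mu mU).
Qed.

(** The excluded points form a countable union of preimages of the null complement of [D]. *)
Lemma invariant_core D : measurable D -> mu D = 1%E ->
  measurable [set x | forall n, D (iter n f x)] /\
  mu [set x | forall n, D (iter n f x)] = 1%E.
Proof.
move=> mD D1.
have CE : [set x | forall n, D (iter n f x)] =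
    ~` \bigcup_n (iter n f @^-1` (~` D)).
  apply/seteqP; split=> x /=; first by move=> h [n _]; apply.
  by move=> h n; apply: contrapT => h'; apply: h; exists n.
have mC : measurable (\bigcup_n (iter n f @^-1` (~` D))).
  by apply: bigcupT_measurable => n; apply/measurable_iterate_preimage/measurableC.
rewrite CE; split; first exact: measurableC.
rewrite probability_setC // iterates_null ?sube0 //; first exact: measurableC.
by rewrite probability_setC // D1 subee.
Qed.

End Invariance.

Lemma probability_dirac (R : realType) (mu : probability R R) (x : R) :
  mu [set x] = 1%E -> forall A, measurable A -> mu A = \d_x A.
Proof.
move=> x1 A mA; rewrite diracE; case: (boolP (x \in A)) => [/set_mem Ax|/negP nAx].
  apply/eqP; rewrite eq_le probability_le1 //= -x1.
  by apply: le_measure; rewrite ?inE // => _ ->.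
have C0 : mu (~` [set x]) = 0%E by rewrite probability_setC // x1 subee.
have : (mu A <= mu (~` [set x]))%E.
  apply: le_measure; rewrite ?inE //; first exact: measurableC.
  by move=> y Ay /= e; apply: nAx; rewrite -e inE.
rewrite C0 => A0; apply/eqP; rewrite mulr0n eq_le measure_ge0 andbT; exact: A0.
Qed.

(** * Real-valued probabilities *)

Section RealProbability.
Context d (T : measurableType d) (R : realType) (mu : probability T R).

Definition pr (A : set T) : R := fine (mu A).

Lemma prE A : measurable A -> mu A = (pr A)%:E.
Proof. by move=> mA; rewrite /pr fineK // fin_num_measure. Qed.

Lemma pr_ge0 A : 0 <= pr A.
Proof. by rewrite /pr fine_ge0. Qed.

Lemma pr_set0 : pr set0 = 0.
Proof. by rewrite /pr measure0. Qed.

Lemma pr_le A B : measurable A -> measurable B -> A `<=` B -> pr A <= pr B.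
Proof.
move=> mA mB AB; rewrite -lee_fin -!prE //.
by apply: le_measure; rewrite ?inE.
Qed.

Lemma pr_setU A B : measurable A -> measurable B -> pr (A `|` B) <= pr A + pr B.
Proof.
move=> mA mB; rewrite -lee_fin EFinD -!prE //; last exact: measurableU.
exact: measureU2.
Qed.

Lemma pr_bigcap_small (E : nat -> set T) r : (forall n, measurable (E n)) ->
  nonincreasing_seq E -> \bigcap_n E n = set0 -> 0 < r -> exists n, pr (E n) < r.
Proof.
move=> mE dE E0 r0.
have : mu \o E @ \oo --> mu (\bigcap_n E n).
  apply: nonincreasing_cvg_mu => //; last by rewrite E0.
  by rewrite (le_lt_trans (probability_le1 _ _)) ?ltry.
rewrite E0 measure0 => /fine_cvg /cvgrPdist_lt /(_ _ r0)[n _ /(_ n)].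
rewrite /= leqnn sub0r normrN => /(_ isT) h; exists n.
exact: le_lt_trans (ler_norm _) h.
Qed.

Lemma pr_bigsetU n (A : nat -> set T) r : (forall i, measurable (A i)) ->
  (forall i, pr (A i) <= r) -> pr (\big[setU/set0]_(i < n) A i) <= n%:R * r.
Proof.
move=> mA Ar; elim: n => [|n IH]; first by rewrite big_ord0 pr_set0 mul0r.
rewrite big_ord_recr /= -natr1 mulrDl mul1r.
apply: le_trans (pr_setU _ _) (lerD IH (Ar n)) => //.
exact: bigsetU_measurable.
Qed.

End RealProbability.

(** * Entropy bounds from a symbolic coding *)

Section Coding.
Context (R : realType) (mu : probability R R) (f : R -> R) (K : set R).
Context (digit : R -> nat).
Hypothesis mf : measurable_fun setT f.
Hypothesis invf : forall A, measurable A -> mu (f @^-1` A) = mu A.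
Hypothesis mK : measurable K.
Hypothesis K1 : mu K = 1%E.
Hypothesis fK : forall x, K x -> K (f x).
Hypothesis mdigit : forall j, measurable [set x | digit x = j].

Fixpoint code n x : seq nat :=
  if n is m.+1 then digit x :: code m (f x) else [::].

Lemma size_code n x : size (code n x) = n.
Proof. by elim: n x => //= n IH x; rewrite IH. Qed.

Lemma take_code l n x : (l <= n)%N -> take l (code n x) = code l x.
Proof.
elim: l n x => [|l IH] [|n] x //=.
by rewrite ltnS => ln; rewrite IH.
Qed.

Lemma drop_code i n x : drop i (code (i + n) x) = code n (iter i f x).
Proof. by elim: i x => [|i IH] x; rewrite ?drop0 //= IH -iterSr. Qed.

Lemma window_code l i n x : (i + l <= n)%N ->
  take l (drop i (code n x)) = code l (iter i f x).
Proof.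
move=> iln; have -> : n = (i + (n - i))%N.
  by rewrite subnKC // (leq_trans _ iln) ?leq_addr.
by rewrite drop_code take_code // leq_subRL ?(leq_trans _ iln) ?leq_addr.
Qed.

Lemma measurable_code (U : set (seq nat)) l : measurable [set x | U (code l x)].
Proof.
elim: l U => [|l IH] U /=.
  have [U0|U0] := pselect (U [::]).
    by rewrite (_ : [set _ | _] = setT) //; apply/seteqP; split.
  by rewrite (_ : [set _ | _] = set0) //; apply/seteqP; split.
rewrite (_ : [set _ | _] = \bigcup_j ([set x | digit x = j] `&`
    f @^-1` [set y | U (j :: code l y)])).
  apply: bigcupT_measurable => j; apply: measurableI => //.
  rewrite -[X in measurable X]setTI.
  exact: (mf measurableT (IH (fun u => U (j :: u)))).
apply/seteqP; split=> x /=; first by exists (digit x).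
by case=> j _ [/= ->].
Qed.

(** * Approximation of Borel sets by unions of cells *)

Definition cell_defect (A : set R) l (U : set (seq nat)) : set R :=
  [set x | K x /\ ~ (A x <-> U (code l x))].

(** The sets with this property form a sigma-algebra; once it contains the rays, it contains all
    Borel sets. *)
Definition cell_approx (A : set R) := measurable A /\
  forall r, 0 < r -> exists l U, pr mu (cell_defect A l U) < r.

Lemma cell_defectE A l U : cell_defect A l U =
  K `&` ((A `\` [set x | U (code l x)]) `|` ([set x | U (code l x)] `\` A)).
Proof.
apply/seteqP; split=> x [Kx h]; split=> //=.
  have [Ax|nAx] := pselect (A x); have [Ux|nUx] := pselect (U (code l x)); tauto.
by case: h => /= -[]; tauto.
Qed.

Lemma measurable_cell_defect A l U : measurable A -> measurable (cell_defect A l U).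
Proof.
move=> mA; rewrite cell_defectE; apply: measurableI => //; apply: measurableU;
  by apply: measurableD => //; exact: measurable_code.
Qed.

(** Reading only the first [l] digits turns a union of cells of order [l] into one of order [n], so
    several approximations can share one order. *)
Lemma cell_defect_level A l n (U : set (seq nat)) : (l <= n)%N ->
  cell_defect A n (fun u => U (take l u)) = cell_defect A l U.
Proof.
by move=> ln; rewrite /cell_defect; under eq_set do rewrite take_code //.
Qed.

Lemma cell_approxC A : cell_approx A -> cell_approx (~` A).
Proof.
move=> [mA AP]; split=> [|r /AP[l [U h]]]; first exact: measurableC.
exists l, (~` U); suff -> : cell_defect (~` A) l (~` U) = cell_defect A l U by [].
apply/seteqP; split=> x [Kx h1]; split=> //=; move: h1; rewrite /setC /=;
have [Ax|nAx] := pselect (A x); have [Ux|nUx] := pselect (U (code l x)); tauto.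
Qed.

Lemma cell_approxU A B : cell_approx A -> cell_approx B -> cell_approx (A `|` B).
Proof.
move=> [mA AP] [mB BP]; split=> [|r r0]; first exact: measurableU.
have r2 : 0 < r / 2 by lra.
have [[l1 [U1 h1]] [l2 [U2 h2]]] := (AP _ r2, BP _ r2).
rewrite -(cell_defect_level _ _ (leq_maxl l1 l2)) in h1.
rewrite -(cell_defect_level _ _ (leq_maxr l1 l2)) in h2.
move: h1 h2; set n := maxn _ _; set V1 := fun _ => _; set V2 := fun _ => _.
move=> h1 h2; exists n, (V1 `|` V2).
apply: le_lt_trans (_ : pr mu (cell_defect A n V1 `|` cell_defect B n V2) < r).
  apply: pr_le.
  - by apply: measurable_cell_defect; exact: measurableU.
  - by apply: measurableU; exact: measurable_cell_defect.
  - move=> x [Kx h]; have [h'|h'] := pselect (A x <-> V1 (code n x)).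
      right; split=> // h''; apply: h; rewrite /setU /=; tauto.
    by left.
apply: le_lt_trans (pr_setU _ _ _) _; try exact: measurable_cell_defect.
lra.
Qed.

Lemma cell_approx0 : cell_approx set0.
Proof.
split=> // r r0; exists 0%N, set0.
rewrite (_ : cell_defect _ _ _ = set0) ?pr_set0 //.
by apply/seteqP; split=> // x [_]; rewrite /set0 /=; tauto.
Qed.

(** Half of [r] pays for replacing the union by a finite one, by continuity from above, and half for
    approximating the finite union by cells. *)
Lemma cell_approx_bigcup (A : nat -> set R) :
  (forall n, cell_approx (A n)) -> cell_approx (\bigcup_n A n).
Proof.
move=> AP; have mA n : measurable (A n) by case: (AP n).
have mU : measurable (\bigcup_n A n) by exact: bigcupT_measurable.
split=> // r r0; have r2 : 0 < r / 2 by lra.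
pose B n := \big[setU/set0]_(i < n) A i.
have BP n : cell_approx (B n).
  elim: n => [|n IH]; rewrite /B; first by rewrite big_ord0; exact: cell_approx0.
  by rewrite big_ord_recr; exact: cell_approxU.
have mB n : measurable (B n) by case: (BP n).
have [|||n hn] := @pr_bigcap_small _ _ _ mu (fun n => \bigcup_n A n `\` B n) _ _ _ _ r2.
- by move=> n; exact: measurableD.
- move=> m n mn; rewrite subsetEset; apply: setDS => x.
  rewrite /B -!bigcup_mkord => -[i /= im Ai]; exists i => //=.
  exact: leq_trans mn.
- apply/seteqP; split=> // x /= h; have [[i _ Ai] _] := h 0%N I.
  have [_] := h i.+1 I; apply; rewrite /B -bigcup_mkord.
  by exists i => /=.
have [l [U hU]] := (BP n).2 _ r2.
exists l, U; apply: le_lt_trans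
  (_ : pr mu ((\bigcup_n A n `\` B n) `|` cell_defect (B n) l U) < r).
  apply: pr_le.
  - exact: measurable_cell_defect.
  - by apply: measurableU; [exact: measurableD|exact: measurable_cell_defect].
  - move=> x [Kx h]; have [Bx|nBx] := pselect (B n x).
      right; split=> // h'; apply: h; split=> [_|_]; first exact/h'.
      by move: Bx; rewrite /B -bigcup_mkord => -[i _ Ai]; exists i.
    have [Ux|nUx] := pselect (U (code l x)).
      by right; split=> // h'; apply/nBx/h'.
    by left; split=> //; apply: contrapT => nA; apply: h.
apply: le_lt_trans (pr_setU _ _ _) _; first exact: measurableD.
  exact: measurable_cell_defect.
lra.
Qed.

Hypothesis small_cells : forall r, 0 < r -> exists l,
  forall x y, K x -> K y -> code l x = code l y -> `|x - y| < r.

(** Only cells with points of [K] on both sides of [q] cause an error. They are short, so the error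
    lies in an interval just right of [q] whose measure tends to 0. *)
Lemma cell_approx_ray (q : R) : cell_approx `]q, +oo[.
Proof.
split=> // r r0.
have [|||n hn] := @pr_bigcap_small _ _ _ mu (fun n => `]q, q + n.+1%:R^-1[%classic)
  _ _ _ _ r0.
- by move=> n.
- move=> m n mn; rewrite subsetEset => x /=; rewrite !in_itv /= => /andP[-> h] /=.
  by rewrite (lt_le_trans h) // lerD2l lef_pV2 ?posrE ?ltr0n // ler_nat.
- apply/seteqP; split=> // x /= h.
  have := h 0%N I; rewrite /= in_itv /= => /andP[qx _].
  have xq : 0 < x - q by rewrite subr_gt0.
  have := h (Num.truncn (x - q)^-1) I; rewrite /= in_itv /= => /andP[_].
  rewrite -ltrBlDl invf_pgt ?posrE ?ltr0n // ltNge => /negP; apply.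
  exact/ltW/truncnS_gt.
have [|l lP] := small_cells (r := n.+1%:R^-1); first by rewrite invr_gt0 ltr0n.
exists l, [set u | ~ exists y, [/\ K y, code l y = u & y <= q]].
apply: le_lt_trans hn; apply: pr_le => //; first exact: measurable_cell_defect.
move=> x [Kx h]; rewrite /= in_itv /=.
have [qx|xq] := ltP q x; last first.
  exfalso; apply: h; rewrite /= in_itv /= andbT; split; first by rewrite ltNge xq.
  by move=> h; exfalso; apply: h; exists x.
rewrite /=; apply: contrapT => h'; apply: h; rewrite /= in_itv /= andbT.
split=> // _ [y [Ky yx yq]]; apply: h'.
have := lP _ _ Kx Ky (esym yx); rewrite ltr_norml => /andP[_].
by move: (_^-1) => e; lra.
Qed.

Lemma cell_approx_measurable A : measurable A -> cell_approx A.
Proof.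
move=> mA; have {mA} : (@RGenOInfty.G R).-sigma.-measurable A.
  by rewrite -RGenOInfty.measurableE.
apply: smallest_sub => [|B [q ->]]; last exact: cell_approx_ray.
split; first exact: cell_approx0.
  by move=> B; rewrite setTD; exact: cell_approxC.
exact: cell_approx_bigcup.
Qed.

(** The atom containing [x] is guessed from the first [l] digits. Outside the [k] defects, each of
    measure below [r / k.+1], membership in every atom is read off correctly from the code, so the
    guess [best] is right. *)
Lemma partition_approx k (P : 'I_k -> set R) r :
  is_fin_meas_partition P -> 0 < r ->
  exists l (best : seq nat -> 'I_k),
    measurable [set x | K x /\ ~ P (best (code l x)) x] /\
    pr mu [set x | K x /\ ~ P (best (code l x)) x] < r.
Proof.
move=> [mP _ cP] r0; have [i0 _] := cP 0.
have rk : 0 < r / k.+1%:R by rewrite divr_gt0 // ltr0n.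
have /choice[a aP] : forall i, exists p : nat * set (seq nat),
    pr mu (cell_defect (P i) p.1 p.2) < r / k.+1%:R.
  by move=> i; have [l [U h]] := (cell_approx_measurable (mP i)).2 _ rk; exists (l, U).
pose l := (\max_(i < k) (a i).1)%N.
pose U i u := (a i).2 (take (a i).1 u).
pose best u := xget i0 [set i | U i u].
exists l, best.
have dU i : cell_defect (P i) l (U i) = cell_defect (P i) (a i).1 (a i).2.
  by apply: cell_defect_level; rewrite /l (leq_bigmax i).
have mbad : measurable [set x | K x /\ ~ P (best (code l x)) x].
  rewrite (_ : [set _ | _] = K `&` ~` \bigcup_(i in setT)
      ([set x | best (code l x) = i] `&` P i)).
    apply: measurableI => //; apply: measurableC; apply: fin_bigcup_measurable.
      exact: finite_finset.
    by move=> i _; apply: measurableI => //; exact: (measurable_code (fun u => best u = i)).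
  apply/seteqP; split=> x /= [Kx h]; split=> //; first by case=> i _ [/= e]; rewrite -e in h *.
  by move=> Px; apply: h; exists (best (code l x)).
split=> //.
(* The defects are extended by the empty set to a sequence indexed by [nat], as [pr_bigsetU]
   expects. *)
pose D j := if insub j is Some i then cell_defect (P i) l (U i) else set0.
have mD j : measurable (D j).
  by rewrite /D; case: insub => [i|//]; exact: measurable_cell_defect.
have Dr j : pr mu (D j) <= r / k.+1%:R.
  rewrite /D; case: insub => [i|]; last by rewrite pr_set0 ltW.
  by rewrite dU ltW.
apply: le_lt_trans (_ : k%:R * (r / k.+1%:R) < r); last first.
  by rewrite mulrCA gtr_pMr // ltr_pdivrMr ?ltr0n // mul1r ltr_nat.
apply: le_trans (pr_bigsetU k mD Dr); apply: pr_le => //.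
  exact: bigsetU_measurable.
move=> x [Kx h]; rewrite -bigcup_mkord; apply: contrapT => nD.
have good i : P i x <-> U i (code l x).
  apply: contrapT => h'; apply: nD; exists (val i); first exact: ltn_ord.
  by rewrite /D valK.
apply: h; apply/good; rewrite /best; case: xgetP => [j -> //|none].
by have [i /good Ui] := cP x; case: (none i).
Qed.

(** * Gibbs' inequality *)

Lemma ln_prod (I : Type) (s : seq I) (F : I -> R) : (forall i, 0 < F i) ->
  ln (\prod_(i <- s) F i) = \sum_(i <- s) ln (F i).
Proof.
move=> F0; elim: s => [|i s IH]; first by rewrite !big_nil ln1.
by rewrite !big_cons lnM ?posrE ?prodr_gt0 // IH.
Qed.

(** Summation of [ln x <= x - 1] at [x = B i / m i], weighted by [m i]; a term with [m i = 0] only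
    uses [0 <= B i]. *)
Lemma gibbs (I : finType) (m B : I -> R) : (forall i, 0 <= m i) ->
  (forall i, 0 < B i) -> \sum_i m i = 1 -> \sum_i B i <= 1 ->
  \sum_i ent_phi (m i) <= \sum_i m i * - ln (B i).
Proof.
move=> m0 B0 m1 B1.
suff : \sum_i (ent_phi (m i) - m i * - ln (B i)) <= \sum_i (B i - m i).
  by rewrite !sumrB m1; lra.
apply: ler_sum => i _; rewrite /ent_phi; case: eqVneq => [->|mi0].
  by rewrite mul0r !subr0 ltW.
have mi : 0 < m i by rewrite lt_def mi0 m0.
have -> : - (m i * ln (m i)) - m i * - ln (B i) = m i * ln (1 + (B i / m i - 1)).
  by rewrite subrKC ln_div ?posrE //; ring.
have := @le_ln1Dx R (B i / m i - 1).
have r0 : 0 < B i / m i by rewrite divr_gt0.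
move=> /(_ ltac:(lra)) /(ler_wpM2l (ltW mi)) /le_trans; apply.
by rewrite mulrBr mulr1 mulrCA divff // mulr1.
Qed.

(** * Entropy bound from weights on words *)

Section EntropyBound.
Context (wds : nat -> seq (seq nat)) (w : seq nat -> R) (g : R -> R) (C : R).
Hypothesis wds_code : forall n x, K x -> code n x \in wds n.
Hypothesis wds_nonempty : forall n, exists t, t \in wds n.
Hypothesis w_gt0 : forall n t, t \in wds n -> 0 < w t.
Hypothesis w_sum : forall n, \sum_(t <- wds n) w t <= 1.
Hypothesis g_bm : bounded_measurable g.
Hypothesis w_code : forall n x, K x ->
  - ln (w (code n x)) <= \sum_(i < n) g (iter i f x) + C.

Section Partition.
Context (k : nat) (P : 'I_k -> set R).
Hypothesis partP : is_fin_meas_partition P.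

Lemma measurable_join_cell n (s : 'I_n -> 'I_k) : measurable (join_cell f P s).
Proof.
rewrite (_ : join_cell _ _ _ =
    \bigcap_(i in setT) (iter (i : 'I_n) f @^-1` P (s i))); last first.
  by apply/seteqP; split=> x /= h i; [move=> _; exact: h|exact: (h i I)].
apply: fin_bigcap_measurable; first exact: finite_finset.
by move=> i _; apply: measurable_iterate_preimage => //; case: partP.
Qed.

(** Exactly one itinerary contains [x], so a single term survives; this turns sums over cells into
    integrals. *)
Lemma join_cell_sum n x (c : {ffun 'I_n -> 'I_k} -> R) :
  exists2 s : {ffun 'I_n -> 'I_k}, join_cell f P s x &
    \sum_(s : {ffun 'I_n -> 'I_k}) c s * \1_(join_cell f P s) x = c s.
Proof.
have [_ dP cP] := partP.
have /choice[s sP] : forall i : 'I_n, exists j, P j (iter i f x) by move=> i.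
pose s0 : {ffun 'I_n -> 'I_k} := [ffun i => s i].
have s0x : join_cell f P s0 x by move=> i; rewrite ffunE.
exists s0 => //; rewrite (bigD1 s0) //= indicE mem_set // mulr1 big1 ?addr0 //.
move=> s1 s10; rewrite indicE memNset ?mulr0 // => s1x.
case/eqP: s10; apply/ffunP => i; apply/eqP/negPn/negP => /dP e.
have : (P (s1 i) `&` P (s0 i)) (iter i f x) by split; [exact: s1x|exact: s0x].
by rewrite e.
Qed.

(* Gibbs' inequality is applied to the weights [q s t]: the word [t] of length
   [n + l] has weight [w t], and the index [s i] is guessed from the window of
   length [l] of [t] at [i], a right guess costing [dl] and a wrong one [beta].
   This replaces the Kolmogorov-Sinai generator theorem. *)
Lemma join_entropy_le r : 0 < r -> exists C', forall n,
  join_entropy mu f P n <= n%:R * (\int[mu]_x g x + r) + C'.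
Proof.
move=> r0; have [_ dP cP] := partP; have [i0 _] := cP 0.
have k0 : (0 < k)%N by case: (k) i0 => // -[].
(* One half of [r] is the cost of a right guess, the other bounds the mean cost of wrong guesses. *)
pose dl := r / 2; have dl0 : 0 < dl by rewrite /dl; lra.
pose e := expR (- dl).
have e0 : 0 < e by exact: expR_gt0.
have e1 : e < 1 by rewrite /e -expR0 ltr_expR; lra.
(* With [e] for the guessed index and [b] for each of the at most [k] others, the guess weights add
   up to at most 1. *)
pose b := (1 - e) / k%:R.
have kR : 1 <= k%:R :> R by rewrite ler1n.
have b0 : 0 < b by rewrite divr_gt0 //; lra.
have b1 : b <= 1 by rewrite ler_pdivrMr; lra.
pose beta := - ln b.
have beta0 : 0 <= beta by rewrite /beta oppr_ge0 ln_le0.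
(* The bad set is so small that [beta] times its measure is at most [dl]. *)
have [|l [best [mbad badr]]] := @partition_approx k P (dl / (beta + 1)) partP.
  by rewrite divr_gt0 //; lra.
set bad := [set x | _] in mbad badr.
pose p u j := if j == best u then e else b.
have p0 u j : 0 < p u j by rewrite /p; case: ifP.
have psum u : \sum_j p u j <= 1.
  rewrite (bigD1 (best u)) //= /p eqxx.
  rewrite (eq_bigr (fun=> b)) => [|j /negbTE -> //].
  rewrite sumr_const.
  have : b *+ #|[pred j | j != best u]| <= b *+ k.
    rewrite -[leLHS]mulr_natr -[leRHS]mulr_natr ler_wpM2l ?(ltW b0) // ler_nat.
    by rewrite -[leqRHS]card_ord max_card.
  by rewrite -[b *+ k]mulr_natr divfK ?gt_eqF //; lra.
have [_ [M gM]] := g_bm.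
(* The windows at the last positions require words of length [n + l]; the [l] extra terms of the
   Birkhoff sum cost at most [l * M]. *)
exists (C + l%:R * M) => n.
pose q (s : {ffun 'I_n -> 'I_k}) t := w t * \prod_(i < n) p (take l (drop i t)) (s i).
pose B s := \sum_(t <- wds (n + l)) q s t.
have q0 s t : t \in wds (n + l) -> 0 < q s t.
  by move=> tw; rewrite mulr_gt0 ?(w_gt0 tw) // prodr_gt0.
have qB s t : t \in wds (n + l) -> q s t <= B s.
  move=> tw; rewrite /B (big_rem t) //= lerDl big_seq sumr_ge0 // => t' /mem_rem t'w.
  exact/ltW/q0.
have B0 s : 0 < B s.
  have [t tw] := wds_nonempty (n + l).
  exact: lt_le_trans (q0 s t tw) (qB s t tw).
have B1 : \sum_s B s <= 1.
  rewrite /B exchange_big /=; apply: le_trans (w_sum (n + l)).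
  rewrite [leLHS]big_seq [leRHS]big_seq; apply: ler_sum => t tw.
  rewrite -mulr_sumr ger_pMr ?(w_gt0 tw) //.
  (* The sum over itineraries of a product is the product over positions of the sums over indices,
     each at most 1. *)
  rewrite -(bigA_distr_bigA (fun i j => p (take l (drop (val i) t)) j)) /=.
  apply: prodr_ile1 => i _; rewrite psum sumr_ge0 // => j _; exact: ltW.
have bmcell (s : {ffun 'I_n -> 'I_k}) : bounded_measurable (\1_(join_cell f P s) : R -> R).
  by apply: bounded_measurable_indic; exact: measurable_join_cell.
have Eind (s : {ffun 'I_n -> 'I_k}) :
    \int[mu]_x (\1_(join_cell f P s) x : R) = pr mu (join_cell f P s).
  by apply: Rintegral_indic; exact: measurable_join_cell.
have Esum (c : {ffun 'I_n -> 'I_k} -> R) :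
    \sum_(s : {ffun 'I_n -> 'I_k}) pr mu (join_cell f P s) * c s =
    \int[mu]_x (\sum_(s : {ffun 'I_n -> 'I_k}) c s * \1_(join_cell f P s) x).
  rewrite Rintegral_sum => [|s]; last exact: bounded_measurableZ.
  apply: eq_bigr => s _; rewrite RintegralZl ?Eind 1?mulrC //.
  exact: bounded_measurable_integrable.
have m1 : \sum_(s : {ffun 'I_n -> 'I_k}) pr mu (join_cell f P s) = 1.
  have := Esum (fun=> 1); under eq_bigr do rewrite mulr1; move=> ->.
  rewrite -[RHS](Rintegral_prob_cst mu 1); apply: eq_Rintegral => x _.
  by have [s _ ->] := @join_cell_sum n x (fun=> 1).
apply: le_trans (gibbs (fun s => pr_ge0 mu _) B0 m1 B1) _.
rewrite Esum.
(* Cost per step: [g] for the word, [dl] for every guess, [beta] more on the bad set. *)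
pose h x := g x + (dl + beta * \1_bad x).
have bmbad : bounded_measurable (\1_bad : R -> R) by exact: bounded_measurable_indic.
have bmh : bounded_measurable h.
  apply: bounded_measurableD => //; apply: bounded_measurableD.
    exact: bounded_measurable_cst.
  exact: bounded_measurableZ.
have bmhi i : bounded_measurable (fun x => h (iter i f x)).
  exact: bounded_measurable_comp (measurable_iterate mf i) bmh.
have Eh : \int[mu]_x h x <= \int[mu]_x g x + r.
  rewrite RintegralD //; [|exact: bounded_measurable_integrable|]; last first.
    apply/bounded_measurable_integrable/bounded_measurableD.
      exact: bounded_measurable_cst.
    exact: bounded_measurableZ.
  rewrite RintegralD //; last first.
  - exact/bounded_measurable_integrable/bounded_measurableZ.
  - exact/bounded_measurable_integrable/bounded_measurable_cst.
  rewrite Rintegral_prob_cst RintegralZl //; last exact: bounded_measurable_integrable.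
  rewrite Rintegral_indic // lerD2l.
  have : beta * pr mu bad <= dl.
    apply: le_trans (_ : beta * (dl / (beta + 1)) <= dl); first by rewrite ler_wpM2l // ltW.
    by rewrite mulrCA ler_piMr ?(ltW dl0) // ler_pdivrMr; lra.
  by rewrite /pr /dl; lra.
have Ehi i : \int[mu]_x h (iter i f x) = \int[mu]_x h x.
  elim: i => //= i <-; under eq_Rintegral do rewrite -iterS iterSr.
  exact: (Rintegral_invariant mf invf (bmhi i)).
apply: le_trans (_ : \int[mu]_x (\sum_(i < n) h (iter i f x) + (C + l%:R * M)) <= _).
  apply: (Rintegral_le_full mK K1).
  - by apply: bounded_measurable_sum => s; exact: bounded_measurableZ.
  - apply: bounded_measurableD; last exact: bounded_measurable_cst.
    by apply: bounded_measurable_sum.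
  move=> x Kx; have [s sx ->] := join_cell_sum x (fun s => - ln (B s)).
  have Kit i : K (iter i f x) by elim: i => //= i; exact: fK.
  have tw := wds_code (n + l) Kx.
  (* Of the sum [B s] only the term of the actual code of [x] is kept. *)
  have h1 : - ln (B s) <= - ln (q s (code (n + l) x)).
    by rewrite lerN2 ler_ln ?posrE ?qB // q0.
  apply: (le_trans h1); rewrite /q lnM ?posrE ?(w_gt0 tw) ?prodr_gt0 //.
  have -> : ln (\prod_(i < n) p (take l (drop i (code (n + l) x))) (s i)) =
      \sum_(i < n) ln (p (code l (iter i f x)) (s i)).
    rewrite ln_prod //; apply: eq_bigr => i _.
    by rewrite window_code // leq_add2r ltnW.
  have h2 := w_code (n + l) Kx.
  rewrite big_split_ord /= in h2.
  have h3 : \sum_(i < l) g (iter (n + i) f x) <= l%:R * M.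
    rewrite -[l in leRHS]card_ord mulr_natl -sumr_const; apply: ler_sum => i _.
    exact: le_trans (ler_norm _) (gM _).
  have h4 : \sum_(i < n) - ln (p (code l (iter i f x)) (s i)) <=
      \sum_(i < n) (dl + beta * \1_bad (iter i f x)).
    apply: ler_sum => i _; rewrite /p; case: eqP => [_|sb].
      by rewrite /e expRK opprK lerDl mulr_ge0 // indicE ler0n.
    rewrite indicE mem_set ?mulr1 ?lerDr ?(ltW dl0) //.
    split=> // Pb; move/eqP: sb => /dP sb.
    have : (P (s i) `&` P (best (code l (iter i f x)))) (iter i f x).
      by split=> //; exact: sx.
    by rewrite sb.
  rewrite sumrN in h4; rewrite /h big_split /=; lra.
rewrite RintegralD //; [|exact/bounded_measurable_integrable/bounded_measurable_sum|];
  last exact/bounded_measurable_integrable/bounded_measurable_cst.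
rewrite Rintegral_prob_cst lerD2r Rintegral_sum //.
under eq_bigr do rewrite Ehi.
by rewrite sumr_const card_ord -[leLHS]mulr_natl ler_wpM2l.
Qed.

(* The maximum with [0] accounts for the value of [lim] on a divergent sequence. *)
Lemma part_entropy_le : part_entropy mu f P <= Num.max 0 (\int[mu]_x g x).
Proof.
rewrite /part_entropy; set u := (fun n => _).
have [cu|dv] := pselect (cvg (u @ \oo)); last first.
  by rewrite (dvgP dv) le_max lexx.
rewrite le_max; apply/orP; right; apply/ler_addgt0Pr => r r0.
have [|C' CP] := @join_entropy_le (r / 2); first lra.
apply: limr_le => //; near=> n.
rewrite /u ler_pdivrMr ?ltr0n //; apply: le_trans (CP n.+1) _.
rewrite mulrC !mulrDl -addrA lerD2l [r * _]mulrC.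
(* For large [n] the constant is absorbed by the second half of [r]. *)
have : C' <= n.+1%:R * (r / 2).
  rewrite -ler_pdivrMr; last lra.
  apply: (@le_trans _ _ n%:R); last by rewrite ler_nat.
  by near: n; exact: nbhs_infty_ger.
by lra.
Unshelve. all: by end_near.
Qed.

End Partition.
End EntropyBound.
End Coding.
(** * Inverse branches of the expanding part *)

Lemma is_derive_continuous (R : realType) (F dF : R -> R) :
  (forall x, is_derive x (1 : R) F (dF x)) -> continuous F.
Proof.
by move=> dFP x; apply/differentiable_continuous/derivable1_diffP.
Qed.

Lemma mean_value (R : realType) (F dF : R -> R) (u v : R) :
  (forall x, u < x < v -> is_derive x (1 : R) F (dF x)) ->
  {within `[u, v], continuous F} ->
  u < v -> exists x, u < x < v /\ F v - F u = dF x * (v - u).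
Proof.
move=> dFP Fc uv.
have dFP' x : x \in `]u, v[ -> is_derive x (1 : R) F (dF x).
  by rewrite in_itv /= => /dFP.
have [x xuv e] := MVT uv dFP' Fc.
by exists x; split=> //; move: xuv; rewrite in_itv.
Qed.

Lemma is_derive_ln_comp (R : realType) (f : R -> R) (x df : R) :
  is_derive x (1 : R) f df -> 0 < f x ->
  is_derive x (1 : R) (fun y => ln (f y)) (df / f x).
Proof.
move=> fd fx; have ld := is_derive1_ln fx.
by rewrite mulrC; have := @is_derive1_comp R (@ln R) f x _ _ ld fd.
Qed.

Section Branches.
Context (R : realType) (F dF : R -> R) (a L c0 del : R) (d : nat).
Hypothesis dFP : forall x, is_derive x (1 : R) F (dF x).
Hypothesis dFc : continuous dF.
Hypothesis dF_gt0 : forall x, 0 < dF x.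
Hypothesis a01 : 0 < a < 1.
Hypothesis d_gt1 : (1 < d)%N.
Hypothesis F0 : F 0 = 0.
Hypothesis Fa : F a = a + d.-1%:R.
Hypothesis dF_gt1 : forall x, 0 < x <= a -> 1 < dF x.
Hypothesis L_ge0 : 0 <= L.
Hypothesis lipL : forall x y, 0 <= x <= a -> 0 <= y <= a ->
  ln (dF x) <= ln (dF y) + L * `|x - y|.
Hypothesis c0_gt0 : 0 < c0.
Hypothesis del_gt0 : 0 < del.
Hypothesis cusp : forall z, 0 < z < del -> c0 <= dF z / F z - z^-1.

Let Fc : continuous F := is_derive_continuous dFP.

Lemma lift_mean_value u v : u < v ->
  exists x, u < x < v /\ F v - F u = dF x * (v - u).
Proof.
by apply: mean_value (fun x _ => dFP x) _; exact: continuous_subspaceT.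
Qed.

Lemma lift_lt : {homo F : x y / x < y}.
Proof.
move=> x y /[dup] xy /lift_mean_value[z [_ e]].
by rewrite -subr_gt0 e mulr_gt0 // subr_gt0.
Qed.

Lemma lift_leE : {mono F : x y / x <= y}.
Proof. exact/le_mono/lift_lt. Qed.

Lemma lift_ltE : {mono F : x y / x < y}.
Proof. exact: leW_mono lift_leE. Qed.

Lemma lift_inj : injective F.
Proof. exact: inc_inj lift_leE. Qed.

(** Inverse of the increasing map [F] from [0, a] onto [0, a + d - 1]; the default 0 only matters
    outside that range. *)
Definition inv_lift y := xget 0 [set z | 0 <= z <= a /\ F z = y].
Local Notation G := inv_lift.

Lemma inv_liftP y : 0 <= y <= a + d.-1%:R -> 0 <= G y <= a /\ F (G y) = y.
Proof.
move=> y_in; rewrite /G; case: xgetP => [z _ []//|/= none].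
have [|||z zin Fz] := @IVT _ F 0 a y.
- by case/andP: a01 => /ltW.
- exact: continuous_subspaceT.
- have h : 0 <= a + d.-1%:R by lra.
  by rewrite F0 Fa (min_idPl h) (max_idPr h).
by case: (none z); split=> //; move: zin; rewrite in_itv.
Qed.

(** The first digit is the outermost branch, so that a suffix of a code describes an iterate. *)
Definition branch (t : seq nat) (y : R) : R :=
  foldr (fun j x => G (x + j%:R)) y t.

Definition word (t : seq nat) : bool := all (fun j => (j < d)%N) t.

Lemma digit_range j y : (j < d)%N -> 0 <= y <= a -> 0 <= y + j%:R <= a + d.-1%:R.
Proof.
move=> jd y_in; have : (j <= d.-1)%N by rewrite -ltnS prednK // (leq_ltn_trans _ jd).
by rewrite -(ler_nat R) => h; have := ler0n R j; move: y_in h; lra.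
Qed.

Lemma branch1P j y : (j < d)%N -> 0 <= y <= a ->
  0 <= G (y + j%:R) <= a /\ F (G (y + j%:R)) = y + j%:R.
Proof. by move=> jd yin; apply/inv_liftP/digit_range. Qed.

Lemma branch1_lt j x y : (j < d)%N -> 0 <= x <= a -> 0 <= y <= a ->
  (G (x + j%:R) < G (y + j%:R)) = (x < y).
Proof.
move=> jd xin yin; rewrite -lift_ltE.
by rewrite !(branch1P jd _).2 // ltrD2r.
Qed.

Lemma branch_range t y : word t -> 0 <= y <= a -> 0 <= branch t y <= a.
Proof.
by elim: t => //= j t IH /andP[jd wt] yin; have [] := branch1P jd (IH wt yin).
Qed.

Lemma branch_lt t x y : word t -> 0 <= x <= a -> 0 <= y <= a ->
  (branch t x < branch t y) = (x < y).
Proof.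
elim: t => //= j t IH /andP[jd wt] xin yin.
by rewrite branch1_lt ?IH ?branch_range.
Qed.

Lemma branch_le t x y : word t -> 0 <= x <= a -> 0 <= y <= a ->
  (branch t x <= branch t y) = (x <= y).
Proof. by move=> wt xin yin; rewrite !leNgt branch_lt. Qed.

Lemma branch_cat s t y : branch (s ++ t) y = branch s (branch t y).
Proof. exact: foldr_cat. Qed.

(** * Expansion and distortion of the inverse branches *)

Lemma branch1_mean_value j u v : (j < d)%N -> 0 <= u -> u < v -> v <= a ->
  exists x, G (u + j%:R) < x < G (v + j%:R) /\
    v - u = dF x * (G (v + j%:R) - G (u + j%:R)).
Proof.
move=> jd u0 uv va.
have uin : 0 <= u <= a by lra.
have vin : 0 <= v <= a by lra.
have [|x [xin e]] := @lift_mean_value (G (u + j%:R)) (G (v + j%:R)).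
  by rewrite branch1_lt.
exists x; split=> //; rewrite -e !(branch1P jd _).2 //; ring.
Qed.

(** Both mean-value points lie in the image of [u, v], so the logarithms of the two slopes differ by
    at most [L] times the length of that image. *)
Lemma branch1_distortion j u' v' u v : (j < d)%N ->
  0 <= u -> u <= u' -> u' < v' -> v' <= v -> v <= a ->
  ln (v' - u') - ln (v - u) - L * (G (v + j%:R) - G (u + j%:R)) <=
  ln (G (v' + j%:R) - G (u' + j%:R)) - ln (G (v + j%:R) - G (u + j%:R)).
Proof.
move=> jd u0 uu' uv' vv' va.
have gle x y : 0 <= x <= a -> 0 <= y <= a -> x <= y -> G (x + j%:R) <= G (y + j%:R).
  by move=> hx hy; rewrite !leNgt branch1_lt.
have [||x [xin ex]] := @branch1_mean_value j u v jd u0; [lra|lra|].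
have [|||y [yin ey]] := @branch1_mean_value j u' v' jd; [lra|lra|lra|].
have h1 : G (u + j%:R) <= G (u' + j%:R) by apply: gle; lra.
have h2 : G (v' + j%:R) <= G (v + j%:R) by apply: gle; lra.
have hu : 0 <= G (u + j%:R) <= a by apply: (branch1P jd _).1; lra.
have hv : 0 <= G (v + j%:R) <= a by apply: (branch1P jd _).1; lra.
rewrite ex ey !lnM ?posrE //; try lra.
have hL : L * `|y - x| <= L * (G (v + j%:R) - G (u + j%:R)).
  by apply: ler_wpM2l => //; rewrite ler_norml; lra.
have := @lipL y x ltac:(lra) ltac:(lra); lra.
Qed.

(** [dF] attains its minimum on the compact interval [r, a], where it exceeds 1. *)
Lemma expansion_away r : 0 < r -> exists2 lam, 0 < lam &
  forall x, r <= x <= a -> 1 + lam <= dF x.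
Proof.
move=> r0; have [ra|ar] := leP r a; last by exists 1 => // x; lra.
have [|z zin zmin] := EVT_min ra (f := dF); first exact: continuous_subspaceT.
exists (dF z - 1) => [|x xin].
  by move: zin; rewrite in_itv /= subr_gt0 => zin; apply: dF_gt1; lra.
by rewrite subrKC; apply: zmin; rewrite in_itv.
Qed.

Lemma inv_lift0 : G 0 = 0.
Proof.
have ha := a01.
have h0 : 0 <= d.-1%:R :> R by rewrite ler0n.
have [|h e] := @inv_liftP 0; first lra.
by apply: lift_inj; rewrite e F0.
Qed.

Lemma inv_lift1P : F (G 1) = 1 /\ 0 < G 1 < a.
Proof.
have ha := a01.
have h : 1 <= d.-1%:R :> R by rewrite ler1n -subn1 subn_gt0.
have [|h1 e] := @inv_liftP 1; first lra.
split=> //; rewrite -lift_ltE F0 -[G 1 < a]lift_ltE e Fa; lra.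
Qed.

Lemma inv_liftaP : F (G a) = a /\ 0 < G a < G 1.
Proof.
have ha := a01.
have h : 0 <= d.-1%:R :> R by rewrite ler0n.
have [|h1 e] := @inv_liftP a; first lra.
split=> //; rewrite -lift_ltE F0 -[G a < G 1]lift_ltE e inv_lift1P.1; lra.
Qed.

(* [A (v - u) + ln v - ln u] is a Lyapunov function for the inverse branches:
   the density [A + 1 / x] absorbs the neutral fixed point, since
   [1 / F x * F' x - 1 / x] tends to [F'' 0 / 2 > 0] at [0]. *)
Lemma branch1_lyapunov : exists2 A, 0 <= A &
  forall j u v, (j < d)%N -> 0 < u -> u < v -> v <= a ->
    0 < G (u + j%:R) /\
    A * (G (v + j%:R) - G (u + j%:R)) + (ln (G (v + j%:R)) - ln (G (u + j%:R)))
      + c0 * (G (v + j%:R) - G (u + j%:R)) <= A * (v - u) + (ln v - ln u).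
Proof.
have ha := a01.
have hc := c0_gt0; have hd := del_gt0.
have [FG1 G1in] := inv_lift1P.
(* Below [r] the bound [cusp] applies and only digit 0 is possible; above [r] the expansion is
   uniform. *)
pose r := Num.min del (G 1).
have r0 : 0 < r by rewrite lt_min; lra.
have [lam lam0 lamP] := expansion_away r0.
have ri : 0 < r^-1 by rewrite invr_gt0.
(* For [z >= r] the gain [A * lam] pays for [c0] and for [z^-1 <= r^-1]. *)
pose A := (c0 + r^-1) / lam.
have A0 : 0 <= A by rewrite divr_ge0 //; lra.
have Alam : A * lam = c0 + r^-1 by rewrite divfK // gt_eqF.
exists A => // j u v jd u0 uv va.
set u1 := G (u + _); set v1 := G (v + _).
have uin : 0 <= u <= a by lra.
have vin : 0 <= v <= a by lra.
have [u1in Fu1] := branch1P jd uin; have [v1in Fv1] := branch1P jd vin.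
rewrite -/u1 -/v1 in u1in Fu1 v1in Fv1.
have j0 := ler0n R j.
have u10 : 0 < u1 by rewrite -lift_ltE F0 Fu1; lra.
have uv1 : u1 < v1 by rewrite branch1_lt.
split=> //.
(* The increment of [h] from [u1] to [v1] is the right side minus the left side of the claim, and
   [dh] turns out nonnegative. *)
pose h z := A * (F z - j%:R) + ln (F z - j%:R) - (A * z + ln z + c0 * z).
pose dh z := A * dF z + dF z / (F z - j%:R) - (A + z^-1 + c0).
have hP z : u1 <= z <= v1 -> is_derive z (1 : R) h (dh z).
  move=> zin; have z0 : 0 < z by lra.
  have Fz : 0 < F z - j%:R.
    have : F u1 <= F z by rewrite lift_leE; lra.
    by rewrite Fu1; lra.
  have d1 : is_derive z (1 : R) (fun z => F z - j%:R) (dF z).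
    by have := dFP z => ?; apply: is_derive_eq; rewrite subr0.
  have d2 := is_derive_ln_comp d1 Fz.
  have d3 := is_derive1_ln z0.
  rewrite /h /dh; apply: is_derive_eq.
  by rewrite /GRing.scale /= !mulr1.
have [||z [zin e]] := @mean_value R h dh u1 v1 _ _ uv1.
- by move=> z zin; apply: hP; lra.
- apply: derivable_within_continuous => z; rewrite in_itv /= => zin.
  by have := hP z zin.
suff : 0 <= h v1 - h u1 by rewrite /h Fu1 Fv1 !addrK; lra.
rewrite e mulr_ge0 //; last lra.
have z0 : 0 < z by lra.
have Fz : 0 < F z - j%:R.
  have : F u1 < F z by rewrite lift_ltE; lra.
  by rewrite Fu1; lra.
have dz : 1 < dF z by apply: dF_gt1; lra.
rewrite /dh; have [rz|zr] := leP r z.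
  have h1 : A * (1 + lam) <= A * dF z.
    by apply: ler_wpM2l => //; apply: lamP; lra.
  have h2 : z^-1 <= r^-1 by rewrite lef_pV2 ?posrE.
  have h3 : 0 <= dF z / (F z - j%:R) by rewrite divr_ge0 // ltW.
  lra.
move: zr; rewrite lt_min => /andP[zd zG].
(* [z < G 1] gives [F z < 1], while [F z > j]. *)
have j00 : j = 0%N.
  apply/eqP; rewrite -leqn0 leqNgt -(ler_nat R); apply/negP => j1.
  have : F z < F (G 1) by rewrite lift_ltE.
  by rewrite FG1; lra.
have := @cusp z ltac:(lra); rewrite j00 subr0 => h1.
have : A * 1 <= A * dF z by apply: ler_wpM2l => //; lra.
lra.
Qed.

(* Bounded distortion on [G a, a]: along a word, [ln] of the ratio of the two
   lengths drops by at most [L] times the current length, and [L / c0] times the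
   Lyapunov function of [branch1_lyapunov] pays for that. *)
Lemma branch_hole : exists2 eta, 0 < eta & forall t, word t ->
  eta * (branch t a - branch t (G a)) <= branch t (G 1) - branch t (G a).
Proof.
have ha := a01.
have hc := c0_gt0.
have [A A0 AP] := branch1_lyapunov.
have [_ G1in] := inv_lift1P; have [_ Gain] := inv_liftaP.
pose Q u w v := ln (w - u) - ln (v - u) - L / c0 * (A * (v - u) + (ln v - ln u)).
exists (expR (Q (G a) (G 1) a)) => [|t wt]; first exact: expR_gt0.
(* [Q] does not decrease when a digit is prepended: the loss by distortion is at most the drop of
   the Lyapunov term. *)
have [v0 Qt] : 0 < branch t (G a) /\
    Q (G a) (G 1) a <= Q (branch t (G a)) (branch t (G 1)) (branch t a).
  elim: t wt => /= [_|j t IH /andP[jd wt]]; first by split; [lra|].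
  have [u0 IHQ] := IH wt.
  have uw : branch t (G a) < branch t (G 1) by rewrite branch_lt //; lra.
  have wv : branch t (G 1) < branch t a by rewrite branch_lt //; lra.
  have va : 0 <= branch t a <= a by rewrite branch_range //; lra.
  have [|u10 h] := AP j _ _ jd u0 _ (proj2 (andP va)); first lra.
  split=> //; apply: (le_trans IHQ).
  have := @branch1_distortion j (branch t (G a)) (branch t (G 1))
    (branch t (G a)) (branch t a) jd ltac:(lra) (lexx _) uw ltac:(lra) ltac:(lra).
  move/(ler_wpM2l (divr_ge0 L_ge0 (ltW c0_gt0))): h.
  rewrite mulrDr (mulrA (L / c0) c0) divfK ?gt_eqF // /Q.
  by rewrite /branch; lra.
have uw : branch t (G a) < branch t (G 1) by rewrite branch_lt //; lra.
have wv : branch t (G 1) < branch t a by rewrite branch_lt //; lra.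
have : Q (G a) (G 1) a <= ln (branch t (G 1) - branch t (G a)) -
    ln (branch t a - branch t (G a)).
  apply: (le_trans Qt); rewrite /Q gerBl mulr_ge0 ?divr_ge0 ?(ltW c0_gt0) //.
  rewrite addr_ge0 ?mulr_ge0 //; first lra.
  by rewrite subr_ge0 ler_ln ?posrE; lra.
rewrite -ln_div ?posrE; [|lra|lra].
rewrite -ler_expR lnK; last by rewrite posrE divr_gt0 //; lra.
by rewrite ler_pdivlMr //; lra.
Qed.

(** * Lengths of cells *)

Definition len t := branch t a - branch t 0.

Lemma len_gt0 t : word t -> 0 < len t.
Proof.
have ha := a01.
by move=> wt; rewrite subr_gt0 branch_lt //; lra.
Qed.

Lemma len_le t : word t -> len t <= a.
Proof.
have ha := a01.
move=> wt; have := @branch_range t 0 wt ltac:(lra).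
by have := @branch_range t a wt ltac:(lra); rewrite /len; lra.
Qed.

Definition nonzero_digits (t : seq nat) := count (fun j => (j != 0)%N) t.

(** Digits are appended on the right: the words [rcons t j] code the subcells of the cell of [t], as
    the induction on the total length requires. *)
Fixpoint words n : seq (seq nat) :=
  if n is m.+1 then [seq rcons t j | t <- words m, j <- iota 0 d] else [:: [::]].

Lemma words_word n t : t \in words n -> word t.
Proof.
elim: n t => [|n IH] t /=; first by rewrite inE => /eqP->.
case/allpairsP => -[s j] /= [/IH ws]; rewrite mem_iota /= add0n => jd ->.
by rewrite /word all_rcons jd.
Qed.

Lemma mem_words n t : size t = n -> word t -> t \in words n.
Proof.
elim: n t => [|n IH] t; first by move/size0nil ->.
case/lastP: t => // t j; rewrite size_rcons => -[st].
rewrite /word all_rcons => /andP[jd wt] /=.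
by apply/allpairsP; exists (t, j); rewrite IH // mem_iota add0n.
Qed.

(* The word [t] followed by a nonzero digit lands in the image of [G 1, a], and
   the adjacent hole has at least a proportion [eta] of its length; this room is
   what the factor [1 + eta] per nonzero digit uses up. *)
Lemma sum_len_words : exists2 eta, 0 < eta & forall n,
  \sum_(t <- words n) len t * (1 + eta) ^+ nonzero_digits t <= a.
Proof.
have ha := a01.
have [eta eta0 etaP] := branch_hole.
have [FG1 G1in] := inv_lift1P; have [FGa Gain] := inv_liftaP.
exists eta => //; elim=> [|n IH]; first by rewrite /= big_seq1 /len /=; lra.
apply: le_trans IH; rewrite /= big_allpairs_dep /=.
rewrite [leLHS]big_seq [leRHS]big_seq; apply: ler_sum => t /words_word wt.
have lenE j : len (rcons t j) = branch t (G (a + j%:R)) - branch t (G j%:R).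
  by rewrite /len -cats1 !branch_cat /= add0r.
(* The subcells of digits 1 to [m] follow each other without overlap between the images of [G 1] and
   [G (a + m)]. *)
have tele m : (0 < m < d)%N -> \sum_(1 <= j < m.+1) len (rcons t j) <=
    branch t (G (a + m%:R)) - branch t (G 1).
  elim: m => [//|[|m] IH] /andP[_ md]; first by rewrite big_nat1 lenE.
  rewrite big_nat_recr //= lenE.
  have := IH (ltnW md).
  have : branch t (G (a + m.+1%:R)) <= branch t (G m.+2%:R).
    have jd := ltnW md.
    have [h1 e1] := @branch1P m.+1 a jd ltac:(lra).
    have [h2 e2] := @branch1P m.+2 0 md ltac:(lra).
    rewrite add0r in h2 e2.
    rewrite branch_le // -lift_leE e1 e2 -natr1; lra.
  by lra.
have [m dE] : exists m, d = m.+2.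
  by case: (d) d_gt1 => [|[|m]] // _; exists m.
have Gd : G (a + m.+1%:R) = a.
  have [|h e] := @branch1P m.+1 a _ ltac:(lra); first by rewrite dE.
  by apply: lift_inj; rewrite e Fa dE.
have nzS j : nonzero_digits (rcons t j.+1) = (nonzero_digits t).+1.
  by rewrite /nonzero_digits -cats1 count_cat addn1.
have nz0 : nonzero_digits (rcons t 0) = nonzero_digits t.
  by rewrite /nonzero_digits -cats1 count_cat addn0.
have -> : iota 0 d = index_iota 0 d by rewrite /index_iota subn0.
rewrite big_ltn; last by rewrite dE.
rewrite nz0 lenE addr0 inv_lift0.
have -> : \sum_(1 <= i < d) len (rcons t i) * (1 + eta) ^+ nonzero_digits (rcons t i)
    = (1 + eta) ^+ nonzero_digits t * ((1 + eta) * \sum_(1 <= i < d) len (rcons t i)).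
  rewrite !mulr_sumr; apply: eq_big_nat => -[//|i] _.
  by rewrite nzS exprS; ring.
rewrite [leLHS]addrC [_ * (1 + eta) ^+ _]mulrC -mulrDr [leRHS]mulrC.
apply: ler_wpM2l; first by apply: exprn_ge0; lra.
have := tele m.+1 ltac:(by rewrite dE ltnSn); rewrite -dE Gd.
have := etaP t wt; rewrite /len.
set S := \sum_(_ <= _ < _) _ => h1 h2.
have h3 : (1 + eta) * S <= (1 + eta) * (branch t a - branch t (G 1)).
  by apply: ler_wpM2l => //; lra.
have uw : branch t (G a) < branch t (G 1) by rewrite branch_lt //; lra.
(* The gain [eta] on the subcells of nonzero digit is covered by the hole between the images of
   [G a] and [G 1]. *)
have : eta * (branch t a - branch t (G 1)) <= eta * (branch t a - branch t (G a)).
  by apply: ler_wpM2l; lra.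
lra.
Qed.

(** If a digit is prepended and the new cell is still at least [r] long, its right part of length
    [r / 2] lies in [r / 2, a], where the slope is at least [1 + lam]. Such a digit shortens the
    cell by at least [lam * (r / 2)], which can happen only boundedly often. *)
Lemma len_small r : 0 < r -> exists M, forall t, word t -> (M <= size t)%N -> len t < r.
Proof.
have ha := a01.
move=> r0; have [|lam lam0 lamP] := @expansion_away (r / 2); first lra.
pose k := lam * (r / 2); have k0 : 0 < k by rewrite mulr_gt0 //; lra.
have grow t : word t -> r <= len t -> len t + (size t)%:R * k <= a.
  elim: t => [_ _|j t IH]; first by rewrite /len /=; lra.
  rewrite /word /= => /andP[jd wt] rl.
  have b0 : 0 <= branch t 0 <= a by rewrite branch_range //; lra.
  have ba : 0 <= branch t a <= a by rewrite branch_range //; lra.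
  have [b0' e0] := branch1P jd b0; have [ba' ea] := branch1P jd ba.
  have step : len (j :: t) + k <= len t.
    have -> : len t = F (branch (j :: t) a) - F (branch (j :: t) 0).
      by rewrite /len /= e0 ea; ring.
    move: rl; rewrite /len; set u := branch _ 0; set v := branch _ a => rl.
    have [|x [xin ex]] := @lift_mean_value (v - r / 2) v; first lra.
    have [|y [yin ey]] := @lift_mean_value u (v - r / 2); first lra.
    have uin : 0 <= u <= a by [].
    have vin : 0 <= v <= a by [].
    have : (1 + lam) * (r / 2) <= dF x * (r / 2).
      by apply: ler_wpM2r; [lra|apply: lamP; lra].
    have : 1 * (v - r / 2 - u) <= dF y * (v - r / 2 - u).
      by apply: ler_wpM2r; [lra|apply/ltW/dF_gt1; lra].
    by move: ex ey; rewrite /k; lra.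
  have := IH wt ltac:(lra).
  by rewrite -natr1; lra.
exists (Num.truncn (a / k)).+1 => t wt /= st; rewrite ltNge; apply/negP => /(grow t wt) h.
have := len_gt0 wt.
have : a < (size t)%:R * k.
  rewrite -ltr_pdivrMr //; apply: lt_le_trans (truncnS_gt _) _.
  by rewrite ler_nat.
lra.
Qed.

(** The length is [a] divided by a product of slopes at mean-value points; each slope is compared
    with the one at [branch (drop i t) y], a point of the same cell, at the cost of [L] times the
    length of that cell. *)
Lemma ln_len_ge t y : word t -> 0 <= y <= a ->
  - ln (len t) <= - ln a + \sum_(i < size t) ln (dF (branch (drop i t) y))
    + L * \sum_(i < size t) len (drop i t).
Proof.
have ha := a01.
move=> + yin; elim: t => [_|j t IH].
  by rewrite !big_ord0 /len /= subr0; lra.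
rewrite /word /= => /andP[jd wt]; rewrite !big_ord_recl /=.
have := IH wt.
under [X in _ -> _ <= _ + (_ + X) + _]eq_bigr do rewrite /= add0n.
set S1 := \sum_(i < _) _; set S2 := \sum_(i < _) _.
have b0 : 0 <= branch t 0 <= a by rewrite branch_range //; lra.
have ba : 0 <= branch t a <= a by rewrite branch_range //; lra.
have lt0 := len_gt0 wt.
have [|||x [xin ex]] := @branch1_mean_value j (branch t 0) (branch t a) jd;
  [lra|move: lt0; rewrite /len; lra|lra|].
have lenj : len t = dF x * len (j :: t) by [].
have wjt : word (j :: t) by rewrite /word /= jd.
rewrite lenj lnM ?posrE ?len_gt0 //.
have [b0' _] := branch1P jd b0; have [ba' _] := branch1P jd ba.
have y1 : branch (j :: t) 0 <= branch (j :: t) y by rewrite branch_le //; lra.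
have y2 : branch (j :: t) y <= branch (j :: t) a by rewrite branch_le //; lra.
have := @lipL x (branch (j :: t) y) ltac:(lra).
move=> /(_ ltac:(move: y1 y2; rewrite /=; lra)).
have : L * `|x - branch (j :: t) y| <= L * len (j :: t).
  by apply: ler_wpM2l => //; rewrite ler_norml /len; move: y1 y2; rewrite /=; lra.
rewrite /=; lra.
Qed.

(** The distortion terms add up to o(n): all but at most [M] of the suffix cells are shorter than
    [r'], and the others have length at most [a < 1]. *)
Lemma ln_len_lower r : 0 < r -> exists C, forall t y, word t -> 0 <= y <= a ->
  - ln (len t) <= C + (size t)%:R * r
    + \sum_(i < size t) ln (dF (branch (drop i t) y)).
Proof.
have ha := a01.
have hL := L_ge0.
move=> r0; pose r' := r / (L + 1).
have r'0 : 0 < r' by rewrite divr_gt0 //; lra.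
have [M MP] := len_small r'0.
have sumlen t : word t ->
    \sum_(i < size t) len (drop i t) <= (size t)%:R * r' + (minn (size t) M)%:R.
  elim: t => [_|j t IH wjt]; first by rewrite big_ord0 mul0r min0n addr0.
  have wt : word t by case/andP: wjt.
  rewrite big_ord_recl /=.
  have := IH wt; set S1 := \sum_(_ < _) _.
  rewrite -natr1.
  have [Ms|sM] := boolP (M <= (size t).+1)%N.
    have := MP (j :: t) wjt Ms.
    have : (minn (size t) M)%:R <= (minn (size t).+1 M)%:R :> R.
      by rewrite ler_nat leq_min geq_minr (leq_trans (geq_minl _ _)).
    lra.
  rewrite -ltnNge in sM.
  rewrite (minn_idPl (ltnW sM)) (minn_idPl (ltnW (ltnW sM))).
  rewrite -natr1; have := len_le wjt; lra.
exists (- ln a + L * M%:R) => t y wt yin.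
have h1 := ln_len_ge wt yin.
have h2 : L * \sum_(i < size t) len (drop i t) <= L * ((size t)%:R * r' + M%:R).
  apply: ler_wpM2l => //; apply: (le_trans (sumlen t wt)).
  by rewrite lerD2l ler_nat geq_minr.
have h3 : L * ((size t)%:R * r') <= (size t)%:R * r.
  rewrite mulrCA ler_wpM2l ?ler0n // /r' mulrCA -[leRHS]mulr1 ler_wpM2l //.
    exact: ltW.
  by rewrite ler_pdivrMr ?mul1r; lra.
lra.
Qed.

(** * Coding of the repeller *)

Local Notation f := (circle_map F).

(** On the repeller, the index of the inverse branch that leads back from [f x] to [x]. *)
Definition digit (x : R) : nat := Num.truncn (F x).

Definition repeller : set R := [set x | forall n, 0 <= iter n f x <= a].

Lemma digitP x : 0 <= x <= a -> 0 <= f x <= a ->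
  [/\ F x = f x + (digit x)%:R, (digit x < d)%N & G (f x + (digit x)%:R) = x].
Proof.
have ha := a01; move=> xin fxin.
have Fx0 : 0 <= F x by rewrite -F0 lift_leE; lra.
have Fxa : F x <= a + d.-1%:R by rewrite -Fa lift_leE; lra.
have FE : F x = f x + (digit x)%:R.
  rewrite /digit truncn_floor Fx0 natr_absz ger0_norm ?floor_ge0 //.
  by rewrite /circle_map /frac1 subrK.
have dd : (digit x < d)%N.
  rewrite -(ltr_nat R); have -> : d%:R = d.-1%:R + 1 :> R.
    by rewrite natr1 prednK // (ltn_trans _ d_gt1).
  lra.
split=> //; apply: lift_inj.
by rewrite (branch1P dd fxin).2.
Qed.

Lemma repeller_iter x n : repeller x -> repeller (iter n f x).
Proof. by move=> Kx m; rewrite -iterD. Qed.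

Lemma repeller_code n x : repeller x ->
  word (code f digit n x) /\ branch (code f digit n x) (iter n f x) = x.
Proof.
elim: n x => [//|n IH] x Kx.
have [||_ dd dE] := @digitP x; [exact: (Kx 0%N)|exact: (Kx 1%N)|].
have [w1 w2] := IH _ (repeller_iter 1 Kx).
by rewrite /= /word /= dd -iterS iterSr w2.
Qed.

Lemma repeller_code_len n x y : repeller x -> repeller y ->
  code f digit n x = code f digit n y -> `|x - y| <= len (code f digit n x).
Proof.
have ha := a01; move=> Kx Ky e.
have [wx ex] := repeller_code n Kx; have [_ ey] := repeller_code n Ky.
rewrite -e in ey; rewrite -[in `|_|]ex -[in `|_|]ey.
have hx := Kx n; have hy := Ky n.
move: wx hx hy; set t := code _ _ _ _; set u := iter n f x; set v := iter n f y.
move=> wt hu hv.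
have h1 : branch t 0 <= branch t u by rewrite branch_le //; lra.
have h2 : branch t u <= branch t a by rewrite branch_le //; lra.
have h3 : branch t 0 <= branch t v by rewrite branch_le //; lra.
have h4 : branch t v <= branch t a by rewrite branch_le //; lra.
by rewrite ler_norml /len; lra.
Qed.

Lemma repeller_small_cells r : 0 < r -> exists l, forall x y, repeller x ->
  repeller y -> code f digit l x = code f digit l y -> `|x - y| < r.
Proof.
move=> /len_small[M MP]; exists M => x y Kx Ky e.
apply: le_lt_trans (repeller_code_len Kx Ky e) (MP _ _ _).
  by have [] := repeller_code M Kx.
by rewrite size_code.
Qed.

(** [x] and 0 share all their codes, and cells shrink to points. *)
Lemma digit_code_zero x : repeller x -> (forall n, digit (iter n f x) = 0%N) -> x = 0.
Proof.
have ha := a01; move=> Kx dx.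
have K0 : repeller 0.
  have f0 : f 0 = 0 by rewrite /circle_map F0 frac1_id // lexx ltr01.
  by move=> n; rewrite (_ : iter n f 0 = 0) ?lexx; [lra|elim: n => //= n ->].
have d0 n : digit (iter n f 0) = 0%N.
  have f0 : f 0 = 0 by rewrite /circle_map F0 frac1_id // lexx ltr01.
  rewrite (_ : iter n f 0 = 0) ?/digit ?F0 ?truncn0 //.
  by elim: n => //= n ->.
have codeE y l : (forall n, digit (iter n f y) = 0%N) ->
    code f digit l y = nseq l 0%N.
  elim: l y => [//|l IH] y dy /=; rewrite (dy 0%N) IH // => n.
  by rewrite -iterSr.
apply/eqP; rewrite -subr_eq0 -normr_le0; apply/ler_addgt0Pr => r /repeller_small_cells.
by move=> [l lP]; rewrite add0r ltW // lP // !codeE.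
Qed.

(** * Entropy of measures carried by the repeller *)

Section Measure.
Context (mu : probability R R).
Hypothesis dF0 : dF 0 = 1.
Hypothesis mu_a : mu [set x | 0 <= x <= a] = 1%E.
Hypothesis invf : forall A, measurable A -> mu (f @^-1` A) = mu A.

Let mf : measurable_fun setT f := measurable_circle_map Fc.

Let m0a : measurable [set x | 0 <= x <= a].
Proof. by rewrite -set_itvcc. Qed.

Let mK : measurable repeller := (invariant_core mf invf m0a mu_a).1.

Let K1 : mu repeller = 1%E := (invariant_core mf invf m0a mu_a).2.

Lemma measurable_digit j : measurable [set x | digit x = j].
Proof.
have := continuous_measurable_fun Fc measurableT (@measurable_truncn R j).
by rewrite setTI.
Qed.

Lemma measurable_digit_neq0 : measurable [set x | digit x != 0%N].
Proof.
rewrite (_ : [set _ | _] = ~` [set x | digit x = 0%N]).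
  by apply: measurableC; exact: measurable_digit.
by apply/seteqP; split=> x /= /eqP.
Qed.

Lemma digit_null_dirac : pr mu [set x | digit x != 0%N] = 0 -> mu [set 0] = 1%E.
Proof.
move=> nz0; have mnz := measurable_digit_neq0.
have : mu (\bigcup_n (iter n f @^-1` [set x | digit x != 0%N])) = 0%E.
  by apply: iterates_null => //; rewrite prE // nz0.
set N := \bigcup_n _ => N0.
have mN : measurable N.
  by apply: bigcupT_measurable => n; exact: measurable_iterate_preimage.
have : pr mu repeller <= pr mu ([set 0] `|` N).
  apply: pr_le => //; first exact: measurableU.
  move=> x Kx; have [Nx|nNx] := pselect (N x); first by right.
  left; apply: digit_code_zero => // n; apply/eqP/negPn/negP => h.
  by apply: nNx; exists n.
have := pr_setU mu (measurable_set1 0) mN.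
rewrite [pr mu N]/pr N0 [pr mu repeller]/pr K1 /= addr0 => h1 h2.
apply/eqP; rewrite eq_le probability_le1 //= prE // lee_fin.
exact: le_trans h2 h1.
Qed.

(** The cut-off outside [0, a], where the measure has no mass, makes the function bounded and
    nonnegative. *)
Definition log_deriv (x : R) : R := ln (dF x) * \1_[set x | 0 <= x <= a] x.

Lemma log_derivE x : 0 <= x <= a -> log_deriv x = ln (dF x).
Proof. by move=> xin; rewrite /log_deriv indicE mem_set ?mulr1. Qed.

Lemma log_deriv_ge0 x : 0 <= log_deriv x.
Proof.
rewrite /log_deriv indicE; case: (boolP (x \in _)) => [/set_mem /= xin|_].
  rewrite mulr1 ln_ge0 //; have [x0|x0] := eqVneq x 0; first by rewrite x0 dF0.
  apply/ltW/dF_gt1; rewrite lt_neqAle eq_sym x0; lra.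
by rewrite mulr0.
Qed.

Lemma log_deriv_bm : bounded_measurable log_deriv.
Proof.
have ha := a01; split.
  apply: measurable_funM; last exact: measurable_indic.
  by apply: measurableT_comp => //; exact: continuous_measurable_fun.
have [|z zin zmax] := @EVT_max _ dF 0 a _ (continuous_subspaceT dFc); first lra.
exists (dF z) => x; rewrite ger0_norm ?log_deriv_ge0 // /log_deriv indicE.
case: (boolP (x \in _)) => [/set_mem /= xin|_]; last by rewrite mulr0 ltW.
rewrite mulr1; apply: le_trans (ltW (ln_sublinear (dF_gt0 x))) (zmax x _).
by rewrite in_itv.
Qed.

Lemma integral_log_deriv :
  (\int[mu]_x (ln `|dF x|)%:E = (\int[mu]_x log_deriv x)%R%:E)%E.
Proof.
rewrite /Rintegral fineK; last first.
  apply: integrable_fin_num => //.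
  exact: (bounded_measurable_integrable mu log_deriv_bm).
apply: ae_eq_integral => //.
- apply/measurable_EFinP; apply: measurableT_comp => //.
  apply: measurableT_comp; first exact: normr_measurable.
  exact: continuous_measurable_fun.
- by apply/measurable_EFinP; case: log_deriv_bm.
have C0 : mu (~` repeller) = 0%E by rewrite probability_setC // K1 subee.
exists (~` repeller); split=> //; first exact: measurableC.
apply: subsetC => x Kx _ /=; rewrite log_derivE ?gtr0_norm //.
exact: (Kx 0%N).
Qed.

(** A nonzero digit means [F x >= 1], hence [x >= G 1], where the expansion is uniform. Positivity
    makes the maximum with 0 in [part_entropy_le] harmless. *)
Lemma integral_log_deriv_gt0 : 0 < pr mu [set x | digit x != 0%N] ->
  0 < \int[mu]_x log_deriv x.
Proof.
move=> nz; have [FG1 G1in] := inv_lift1P.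
have [|lam lam0 lamP] := @expansion_away (G 1); first lra.
have ll : 0 < ln (1 + lam) by apply: ln_gt0; lra.
apply: lt_le_trans (_ : ln (1 + lam) * pr mu [set x | digit x != 0%N] <= _).
  exact: mulr_gt0.
have bmnz := bounded_measurable_indic R measurable_digit_neq0.
rewrite /pr -Rintegral_indic; last exact: measurable_digit_neq0.
rewrite -RintegralZl //; last exact: bounded_measurable_integrable.
apply: (Rintegral_le_full mK K1).
- exact: bounded_measurableZ.
- exact: log_deriv_bm.
move=> x Kx; rewrite indicE; case: (boolP (x \in _)) => [/set_mem /= dx|_]; last first.
  by rewrite mulr0 log_deriv_ge0.
have xin := Kx 0%N; rewrite /= in xin; rewrite mulr1 log_derivE //.
rewrite ler_ln ?posrE //; last lra.
apply: lamP; rewrite -lift_leE FG1 (proj2 (andP xin)) andbT.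
by rewrite -truncn_gt0 lt0n.
Qed.

(** If nonzero digits had positive probability, the weights [w] would bound the entropy strictly
    below the integral of [ln dF]. *)
Lemma repeller_entropy_dirac :
  KS_entropy mu f = (\int[mu]_x (ln `|dF x|)%:E)%E -> mu [set 0] = 1%E.
Proof.
move=> KS; apply: digit_null_dirac; apply/eqP/negPn/negP => nz0.
have nz : 0 < pr mu [set x | digit x != 0%N] by rewrite lt_def nz0 pr_ge0.
have u0 := integral_log_deriv_gt0 nz.
have [eta eta0 etaP] := sum_len_words.
pose eps := ln (1 + eta); have eps0 : 0 < eps by apply: ln_gt0; lra.
(* Half of the mean gain, so that the final bound is the integral of [log_deriv] minus [r]. *)
pose r := eps * pr mu [set x | digit x != 0%N] / 2.
have r0 : 0 < r by rewrite divr_gt0 ?mulr_gt0.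
have [C CP] := ln_len_lower r0.
pose w t := len t * (1 + eta) ^+ nonzero_digits t.
pose h x := (- eps) * \1_[set x | digit x != 0%N] x + r.
pose g x := log_deriv x + h x.
have bmnz := bounded_measurable_indic R measurable_digit_neq0.
have bmh : bounded_measurable h.
  apply: bounded_measurableD; last exact: bounded_measurable_cst.
  exact: bounded_measurableZ.
have bmg : bounded_measurable g.
  by apply: bounded_measurableD => //; exact: log_deriv_bm.
have Eg : \int[mu]_x g x = \int[mu]_x log_deriv x - r.
  rewrite RintegralD //; try exact: bounded_measurable_integrable;
    last exact: (bounded_measurable_integrable mu log_deriv_bm).
  congr (_ + _); rewrite RintegralD //; last first.
  - exact/bounded_measurable_integrable/bounded_measurable_cst.
  - exact/bounded_measurable_integrable/bounded_measurableZ.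
  rewrite RintegralZl //; last exact: bounded_measurable_integrable.
  rewrite Rintegral_indic; last exact: measurable_digit_neq0.
  by rewrite Rintegral_prob_cst /r /pr; lra.
suff : (KS_entropy mu f <= (Num.max 0 (\int[mu]_x g x))%:E)%E.
  rewrite KS integral_log_deriv lee_fin leNgt => /negP; apply.
  by rewrite gt_max u0 Eg; lra.
apply: ge_ereal_sup => _ [k [P [partP ->]]]; rewrite lee_fin.
apply: (@part_entropy_le R mu f repeller digit mf invf mK K1 _ measurable_digit
  repeller_small_cells words w g C _ _ _ _ bmg _ k P partP).
- by move=> x; exact: (repeller_iter 1).
- by move=> n x Kx; apply: mem_words; [rewrite size_code|have [] := repeller_code n Kx].
- move=> n; exists (nseq n 0%N); apply: mem_words; first exact: size_nseq.
  by rewrite /word all_nseq (ltn_trans _ d_gt1) ?orbT.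
- move=> n t /words_word wt; rewrite /w mulr_gt0 ?len_gt0 // exprn_gt0 //; lra.
- by move=> n; apply: le_trans (etaP n) _; case/andP: a01 => _ /ltW.
move=> n x Kx; have [wt ex] := repeller_code n Kx.
have := CP _ _ wt (Kx n); rewrite size_code.
(* The branches along the suffixes of the code bring the [n]-th iterate back to the earlier ones. *)
have -> : \sum_(i < n) ln (dF (branch (drop i (code f digit n x)) (iter n f x))) =
    \sum_(i < n) log_deriv (iter i f x).
  apply: eq_bigr => i _; rewrite log_derivE; last exact: Kx.
  have nE : n = (i + (n - i))%N by rewrite subnKC // ltnW.
  rewrite [in code _ _ _ _]nE drop_code [in iter n _ _]nE addnC iterD.
  by rewrite (repeller_code (n - i) (repeller_iter i Kx)).2.
have -> : \sum_(i < n) g (iter i f x) = \sum_(i < n) log_deriv (iter i f x) -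
    eps * (nonzero_digits (code f digit n x))%:R + n%:R * r.
  rewrite big_split /= -addrA; congr (_ + _); rewrite big_split /=; congr (_ + _).
    rewrite -mulr_sumr mulNr; congr (- (_ * _)).
    elim: n x {Kx wt ex} => [|n IH] x; first by rewrite big_ord0.
    rewrite big_ord_recl /= natrD; under eq_bigr do rewrite -iterS iterSr.
    rewrite IH; congr (_ + _); rewrite indicE.
    by case: (boolP (x \in _)) => [/set_mem /= -> //|/negP]; rewrite inE /= => /negP/negbTE ->.
  by rewrite sumr_const card_ord mulr_natl.
rewrite /w lnM ?posrE ?len_gt0 ?exprn_gt0 //; last lra.
rewrite lnXn; last lra.
by rewrite -/eps -[eps *+ _]mulr_natr; lra.
Qed.

End Measure.
End Branches.
(** * Dynamics near the saddle-node *)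

Section ContinuousFunctions.
Context (R : realType).

Lemma continuous_gt_near (h : R -> R) x v : continuous h -> v < h x ->
  exists2 e, 0 < e & forall y, `|y - x| < e -> v < h y.
Proof.
move=> hc vh; have : \forall y \near x, v < h y by exact: (cvgr_gt _ (hc x)).
move=> /nbhs_ballP[e /= e0 eP].
by exists e => // y yx; apply: eP; rewrite /ball /= distrC.
Qed.

Lemma continuous_lt_near (h : R -> R) x v : continuous h -> h x < v ->
  exists2 e, 0 < e & forall y, `|y - x| < e -> h y < v.
Proof.
move=> hc hv; have : \forall y \near x, h y < v by exact: (cvgr_lt _ (hc x)).
move=> /nbhs_ballP[e /= e0 eP].
by exists e => // y yx; apply: eP; rewrite /ball /= distrC.
Qed.

(** [p] is the largest point of the compact set where [h <= 0]; a negative value at [p] would give a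
    later zero. *)
Lemma last_zero (h : R -> R) u v : continuous h -> u <= v -> h u <= 0 -> 0 < h v ->
  exists p, [/\ u <= p < v, h p = 0 & forall x, p < x <= v -> 0 < h x].
Proof.
move=> hc uv hu hv; pose S := `[u, v]%classic `&` (h @^-1` [set y | y <= 0]).
have Su : S u by split=> //=; rewrite in_itv /= lexx.
have Sc : compact S.
  apply: (subclosed_compact _ (@segment_compact _ u v)); last by move=> x [].
  apply: closedI; first exact: interval_closed.
  by apply: preimage_closed => // x _; exact: hc.
have [|p /set_mem[+ hp] pmax] := compact_EVT_max (f := id) (ex_intro _ u Su) Sc.
  by apply: continuous_subspaceT => x; exact: cvg_id.
rewrite /= in_itv /= in hp * => puv.
have above x : p < x <= v -> 0 < h x.
  move=> xin; rewrite ltNge; apply/negP => hx.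
  have /mem_set/pmax : S x by split=> //=; rewrite in_itv /=; lra.
  by move=> /= ?; lra.
have pv : p < v.
  by rewrite lt_neqAle (proj2 (andP puv)) andbT; apply: contraTneq hv => <-; rewrite -leNgt.
exists p; split=> //; first lra.
apply/eqP; rewrite eq_le hp /=; rewrite leNgt; apply/negP => hp0.
have [|||q qin hq] := @IVT _ h p v 0; first lra.
- exact: continuous_subspaceT.
- have h1 : h p <= h v by lra.
  by rewrite (min_idPl h1) (max_idPr h1); lra.
move: qin; rewrite in_itv /= => qin.
have [pq|pq] := eqVneq p q; first by rewrite pq hq ltxx in hp0.
have := above q; rewrite hq ltxx lt_neqAle pq => h'.
by have := h' ltac:(lra).
Qed.

Lemma first_zero (h : R -> R) u v : continuous h -> u <= v -> 0 < h u -> h v <= 0 ->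
  exists p, [/\ u < p <= v, h p = 0 & forall x, u <= x < p -> 0 < h x].
Proof.
move=> hc uv hu hv.
have hNc : continuous (h \o -%R).
  by move=> x; apply: continuous_comp; [exact: opp_continuous|exact: hc].
have [|||p [pin hp pP]] := @last_zero (h \o -%R) (- v) (- u) hNc.
- lra.
- by rewrite /= opprK.
- by rewrite /= opprK.
exists (- p); split=> //; first lra.
by move=> x xin; have := pP (- x); rewrite /= opprK; apply; lra.
Qed.

Lemma continuous_iter (h : R -> R) n : continuous h -> continuous (iter n h).
Proof.
move=> hc; elim: n => [|n IH] x; first exact: cvg_id.
exact: (continuous_comp (IH x) (hc _)).
Qed.

(** A bounded monotone orbit converges, and by continuity its limit is fixed. *)
Lemma nondecreasing_orbit_fixed (h : R -> R) x B : continuous h ->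
  (forall n, iter n h x <= iter n.+1 h x) -> (forall n, iter n h x <= B) ->
  exists l, [/\ x <= l, l <= B & h l = l].
Proof.
move=> hc inc bnd; pose u n := iter n h x.
have und : nondecreasing_seq u by apply/nondecreasing_seqP.
have ucv : cvgn u.
  by apply: nondecreasing_is_cvgn => //; exists B => _ [n _ <-]; exact: bnd.
exists (limn u); split; first exact: (nondecreasing_cvgn_le und ucv 0%N).
  by apply: limr_le => //; near=> n; exact: bnd.
have h1 : (h \o u) @ \oo --> h (limn u) by apply: continuous_cvg => //; exact: hc.
have h2 : (h \o u) @ \oo --> limn u by have := ucv; rewrite -(cvg_shiftS u).
by rewrite -(cvg_lim _ h1) // (cvg_lim _ h2).
Unshelve. all: by end_near.
Qed.

End ContinuousFunctions.

(** * Local analysis of the lift at the saddle-node *)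

Section SaddleNode.
Context (R : realType) (F dF ddF : R -> R) (deg : int).
Hypothesis dFP : forall x, is_derive x (1 : R) F (dF x).
Hypothesis ddFP : forall x, is_derive x (1 : R) dF (ddF x).
Hypothesis ddFc : continuous ddF.
Hypothesis per : forall x, F (x + 1) = F x + deg%:~R.
Hypothesis dF_neq0 : forall x, dF x != 0.
Hypothesis F0 : F 0 = 0.
Hypothesis dF0 : dF 0 = 1.
Hypothesis ddF0 : 0 < ddF 0.

Let Fc : continuous F := is_derive_continuous dFP.
Let dFc : continuous dF := is_derive_continuous ddFP.

(** [dF] has no zero and equals 1 at 0, so by the intermediate value theorem it keeps its sign. *)
Lemma deriv_gt0 x : 0 < dF x.
Proof.
rewrite lt_neqAle eq_sym dF_neq0 /= leNgt; apply/negP => dx.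
have z (h : R -> R) u v : continuous h -> u <= v -> h u < 0 -> 0 < h v ->
    exists p, h p = 0.
  by move=> hc uv hu hv; have [p [_ hp _]] := last_zero hc uv (ltW hu) hv; exists p.
have [x0|x0] := leP x 0.
  have [|p /eqP] := z dF x 0 dFc x0 dx; first by rewrite dF0.
  by rewrite (negbTE (dF_neq0 p)).
have dFNc : continuous (fun y => - dF y) by move=> y; apply: continuousN; exact: dFc.
have [||p /eqP] := z (fun y => - dF y) 0 x dFNc (ltW x0).
- by rewrite dF0 oppr_lt0.
- by rewrite oppr_gt0.
by rewrite oppr_eq0 (negbTE (dF_neq0 p)).
Qed.

Let FleE := lift_leE dFP deriv_gt0.
Let FltE := lift_ltE dFP deriv_gt0.

Lemma deriv_mean_value u v : u < v ->
  exists x, u < x < v /\ dF v - dF u = ddF x * (v - u).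
Proof. by move=> uv; apply: (lift_mean_value ddFP). Qed.

Lemma second_deriv_pos : exists2 e, 0 < e &
  forall y, `|y| < e -> ddF 0 / 2 < ddF y /\ dF y < 2.
Proof.
have [|e1 e10 e1P] := @continuous_gt_near _ ddF 0 (ddF 0 / 2) ddFc.
  by have := ddF0; lra.
have [|e2 e20 e2P] := @continuous_lt_near _ dF 0 2 dFc; first by rewrite dF0; lra.
exists (Num.min e1 e2) => [|y]; first by rewrite lt_min e10.
by rewrite lt_min => /andP[y1 y2]; split; [apply: e1P|apply: e2P]; rewrite subr0.
Qed.

(** Near 0 the derivative increases through the value 1, so the graph lies above its tangent, the
    diagonal. *)
Lemma lift_gt_near0 : exists2 e, 0 < e & forall x, x != 0 -> `|x| < e -> x < F x.
Proof.
have [e e0 eP] := second_deriv_pos; have hdd := ddF0; exists e => // x x0.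
rewrite ltr_norml => xe; have hF0 := F0; have hd0 := dF0.
have [xn|xp] := ltP x 0.
  have [y [yin ey]] := lift_mean_value dFP xn.
  have [|z [zin ez]] := @deriv_mean_value y 0; first lra.
  have [|zp _] := eP z; first by rewrite ltr_norml; lra.
  have : 0 < ddF z * (0 - y) by rewrite mulr_gt0 //; lra.
  rewrite -ez dF0 => dy.
  have : 0 < (1 - dF y) * (0 - x) by rewrite mulr_gt0 //; lra.
  lra.
have {}xp : 0 < x by rewrite lt_neqAle eq_sym x0.
have [y [yin ey]] := lift_mean_value dFP xp.
have [|z [zin ez]] := @deriv_mean_value 0 y; first lra.
have [|zp _] := eP z; first by rewrite ltr_norml; lra.
have : 0 < ddF z * (y - 0) by rewrite mulr_gt0 //; lra.
rewrite -ez dF0 => dy.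
have : 0 < (dF y - 1) * (x - 0) by rewrite mulr_gt0 //; lra.
lra.
Qed.

(** The difference is [(z * dF z - F z) / (z * F z)]. Its numerator is at least
    [ddF 0 / 4 * z ^+ 2], and [F z <= 2 * z]; hence the constant [ddF 0 / 8]. *)
Lemma deriv_cusp : exists c0 del, [/\ 0 < c0, 0 < del &
  forall z, 0 < z < del -> c0 <= dF z / F z - z^-1].
Proof.
have [e e0 eP] := second_deriv_pos; have hdd := ddF0; have hF0 := F0.
exists (ddF 0 / 8), e; split=> //; first lra.
move=> z zin; have z0 : 0 < z by lra.
(* [k] vanishes at 0 and has a nonnegative derivative on (0, e). *)
pose k y := y * dF y - F y - ddF 0 / 4 * (y * y).
pose dk y := y * (ddF y - ddF 0 / 2).
have kP y : is_derive y (1 : R) k (dk y).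
  have := dFP y => ?; have := ddFP y => ?.
  rewrite /k; apply: is_derive_eq; rewrite /dk /GRing.scale /=; lra.
have [|y [yin ey]] := @mean_value R k dk 0 z (fun x _ => kP x) _ z0.
  by apply: continuous_subspaceT; exact: is_derive_continuous kP.
have [|y1 _] := eP y; first by rewrite ltr_norml; lra.
have : 0 <= dk y * (z - 0) by rewrite /dk !mulr_ge0 //; lra.
rewrite -ey /k F0 !mul0r mulr0 subr0 => kz.
have [x [xin ex]] := lift_mean_value dFP z0.
have [|_ x2] := eP x; first by rewrite ltr_norml; lra.
have Fz0 : 0 < F z by rewrite -F0 FltE.
have Fz2 : F z <= 2 * z.
  have : 0 <= (2 - dF x) * (z - 0) by rewrite mulr_ge0 //; lra.
  lra.
have -> : dF z / F z - z^-1 = (z * dF z - F z) / (z * F z).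
  by field; rewrite !gt_eqF.
rewrite ler_pdivlMr ?mulr_gt0 //.
have : 0 <= ddF 0 / 8 * (z * (2 * z - F z)) by rewrite !mulr_ge0 //; lra.
lra.
Qed.

(** Mean value theorem for [ln dF], whose derivative [ddF / dF] is bounded on [0, a]. *)
Lemma ln_deriv_lipschitz a : 0 < a -> exists2 L, 0 <= L &
  forall x y, 0 <= x <= a -> 0 <= y <= a -> ln (dF x) <= ln (dF y) + L * `|x - y|.
Proof.
move=> a0; pose h x := ddF x / dF x.
have hc : continuous (fun x => `|h x|).
  move=> x; apply: continuous_comp; last exact: norm_continuous.
  by apply: continuousM; [exact: ddFc|apply: continuousV; [exact: dF_neq0|exact: dFc]].
have [z _ zP] := EVT_max (ltW a0) (continuous_subspaceT hc).
exists `|h z| => // x y xin yin.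
have main u v : 0 <= u -> u < v -> v <= a ->
    `|ln (dF v) - ln (dF u)| <= `|h z| * (v - u).
  move=> u0 uv va.
  have lP w : is_derive w (1 : R) (fun w => ln (dF w)) (h w).
    by apply: is_derive_ln_comp => //; exact: deriv_gt0.
  have [|w [win ->]] := @mean_value R _ h u v (fun w _ => lP w) _ uv.
    by apply: continuous_subspaceT; exact: is_derive_continuous lP.
  rewrite normrM [`|v - u|]ger0_norm; last lra.
  by apply: ler_wpM2r; [lra|apply: zP; rewrite in_itv /=; lra].
have [xy|yx|->] := ltgtP x y; last by rewrite subrr normr0 mulr0 addr0.
- have := main x y ltac:(lra) xy ltac:(lra).
  rewrite [`|x - y|]distrC [`|y - x|]ger0_norm ?ler_norml; lra.
- have := main y x ltac:(lra) yx ltac:(lra).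
  rewrite [`|x - y|]ger0_norm ?ler_norml; lra.
Qed.

Lemma degree_nat : exists2 d : nat, (0 < d)%N & deg = d%:Z.
Proof.
have : 0 < F 1 by rewrite -F0 FltE.
by rewrite -[1]add0r per F0 add0r ltr0z; case: deg => // n n0; exists n.
Qed.

(** [F (-1) = - deg <= -1], while [x < F x] just left of 0; [p] is the last zero of [F x - x] in
    between. *)
Lemma last_fixed_point : exists p, [/\ -1 <= p < 0, F p = p &
  forall x, p < x < 0 -> x < F x].
Proof.
have [e e0 eP] := lift_gt_near0; have [d d0 dE] := degree_nat.
have FN1 : F (-1) <= -1.
  have := per (-1); rewrite addNr F0 dE => h.
  have : 1 <= d%:R :> R by rewrite ler1n.
  by move: h; rewrite -pmulrn; lra.
pose v := - (Num.min e 1 / 2).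
have m0 : 0 < Num.min e 1 by rewrite lt_min e0 ltr01.
have m1 : Num.min e 1 <= 1 by rewrite ge_min lexx orbT.
have me : Num.min e 1 <= e by rewrite ge_min lexx.
have near0 x : v <= x < 0 -> x < F x.
  move=> xin; apply: eP; first by rewrite lt_eqF; lra.
  by rewrite ltr_norml; move: xin; rewrite /v; lra.
have hc : continuous (fun x => F x - x).
  by move=> x; apply: continuousB; [exact: Fc|exact: cvg_id].
have vF : v < F v by apply: near0; rewrite /v; lra.
have [||| p [pin hp pP]] := @last_zero _ (fun x => F x - x) (-1) v hc.
- by rewrite /v; lra.
- lra.
- lra.
exists p; split; [by move: pin; rewrite /v; lra|lra|].
move=> x xin; have [xv|vx] := leP x v; last by apply: near0; lra.
by have := pP x ltac:(lra); lra.
Qed.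

(** * Iterates of the circle map and the basin of 0 *)

Local Notation f := (circle_map F).

Let mf : measurable_fun setT f := measurable_circle_map Fc.

Lemma lift_addz x (m : int) : F (x + m%:~R) = F x + (deg * m)%:~R.
Proof.
have addn y (n : nat) : F (y + n%:R) = F y + (deg * n%:Z)%:~R.
  elim: n => [|n IH]; first by rewrite mulr0 !addr0.
  by rewrite -natr1 addrA per IH intS mulrDr mulr1 intrD; ring.
case: m => n; first exact: addn.
have := addn (x - n.+1%:R) n.+1; rewrite subrK => ->.
by rewrite NegzE mulrN !mulrNz -addrA subrr addr0.
Qed.

Lemma circle_map_addz x (m : int) : f (x + m%:~R) = f x.
Proof. by rewrite /circle_map lift_addz frac1Dz. Qed.

(** Stated for at least one step, because [x] itself need not lie in [0, 1). *)
Lemma iter_circle_map n x : iter n.+1 f x = frac1 (iter n.+1 F x).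
Proof.
elim: n => [//|n IH]; rewrite iterS IH /frac1 -mulrNz circle_map_addz.
by [].
Qed.

(** From time [n] on the orbit sits at [b], at a constant positive distance from 0. *)
Lemma basin_eventually_fixed n x b : 0 < b < 1 -> f b = b -> iter n f x = b ->
  ~ basin0_lift F x.
Proof.
move=> b01 fb xb; rewrite /basin0_lift /= => /cvgrPdist_lt h.
have c0 : 0 < circ_dist0 b.
  by rewrite /circ_dist0 frac1_id ?lt_min; lra.
have [N _ /(_ (N + n)%N)] := h _ c0.
rewrite /= leq_addr => /(_ isT); rewrite iterD xb.
have -> : iter N f b = b by elim: {h} N => //= N ->.
by rewrite sub0r normrN ger0_norm ?ltxx // ltW.
Qed.

Lemma component_interval x y z : connected_component (basin0_lift F) 0 x ->
  connected_component (basin0_lift F) 0 y -> x <= z <= y ->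
  connected_component (basin0_lift F) 0 z.
Proof.
move=> Cx Cy; have : connected (connected_component (basin0_lift F) 0).
  exact: component_connected.
by move/connected_intervalP; apply; [exact: Cx|exact: Cy].
Qed.

Lemma component0 y : connected_component (basin0_lift F) 0 y ->
  connected_component (basin0_lift F) 0 0.
Proof.
move=> [A [A0 AB Ac] Ay]; apply: connected_component_refl; exact: AB.
Qed.

(** * The largest negative fixed point and the immediate basin *)

Section FixedPoint.
Context (p : R).
Hypothesis pin : -1 <= p < 0.
Hypothesis Fp : F p = p.
Hypothesis F_gt : forall x, p < x < 0 -> x < F x.

Lemma lift_left_basin x : p < x < 0 -> p < F x < 0.
Proof. by move=> xin; rewrite -{1}Fp -F0 !FltE. Qed.

Lemma iter_left_basin n x : p < x < 0 -> p < iter n F x < 0.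
Proof. by move=> xin; elim: n => //= n; exact: lift_left_basin. Qed.

(** The intervals [E n] decrease to the empty set, since a common point would give a fixed point of
    [F] between [p] and 0. Their measures do not decrease, because [f] maps [E n] into [E n.+1]; so
    they vanish. *)
Lemma left_basin_null (mu : probability R R) :
  (forall A, measurable A -> mu (f @^-1` A) = mu A) -> mu `]p + 1, 1[%classic = 0%E.
Proof.
have hp := pin; move=> inv.
have main x : p < x < 0 -> mu `[x + 1, 1[%classic = 0%E.
  move=> xin; pose E n := `[iter n F x + 1, 1[%classic.
  have mE n : measurable (E n) by exact: measurable_itv.
  have itin n := iter_left_basin n xin.
  have step n : pr mu (E n) <= pr mu (E n.+1).
    have -> : pr mu (E n.+1) = pr mu (f @^-1` E n.+1) by rewrite /pr inv.
    apply: pr_le => //; first by rewrite -[X in measurable X]setTI; exact: mf.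
    move=> y; rewrite /E /= !in_itv /= => yin.
    have hx := itin n.
    have h1 : F (iter n F x) <= F (y - 1) by rewrite FleE; lra.
    have h2 : p < F (y - 1) < 0 by apply: lift_left_basin; lra.
    have -> : f y = F (y - 1) + 1.
      rewrite -[y in LHS](subrK 1) -[1 in LHS]/(1%:~R) circle_map_addz /circle_map.
      rewrite -(frac1Dz _ 1) frac1_id //; lra.
    lra.
  have E0 n : pr mu (E 0%N) <= pr mu (E n).
    by elim: n => // n IH; exact: le_trans IH (step n).
  have inc n : iter n F x <= iter n.+1 F x by rewrite iterS ltW // F_gt.
  rewrite -/(E 0%N) prE //; congr EFin; apply/eqP; rewrite eq_le pr_ge0 andbT.
  apply/ler_addgt0Pr => r r0; rewrite add0r.
  have [|||n hn] := @pr_bigcap_small _ _ _ mu E r mE.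
  - apply/nonincreasing_seqP => n; rewrite subsetEset => y; rewrite /E /= !in_itv /=.
    by have := inc n; rewrite /=; lra.
  - apply/seteqP; split=> // y yE.
    have [|l [xl ly Fl]] := @nondecreasing_orbit_fixed _ F x (y - 1) Fc inc.
      by move=> n; have := yE n I; rewrite /E /= in_itv /=; lra.
    have := yE 0%N I; rewrite /E /= in_itv /= => y1.
    by have := @F_gt l ltac:(lra); rewrite Fl ltxx.
  - by [].
  exact: le_trans (E0 n) (ltW hn).
have : mu.-negligible `]p + 1, 1[%classic.
  (* The points [p - p / k.+2] lie between [p] and 0 and tend to [p]. *)
  have -> : `]p + 1, 1[%classic = \bigcup_k `[p + 1 - p / k.+2%:R, 1[%classic.
    apply/seteqP; split=> x /=; rewrite in_itv /=.
      move=> xin; have xp : 0 < x - (p + 1) by lra.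
      exists (Num.truncn (- p / (x - (p + 1)))) => //=; rewrite in_itv /=.
      have := truncnS_gt (- p / (x - (p + 1))); set k := Num.truncn _ => kP.
      suff : - (p / k.+2%:R) <= x - (p + 1) by move: (p / _) => q; lra.
      rewrite -mulNr ler_pdivrMr ?ltr0n // mulrC -ler_pdivrMr // (le_trans (ltW kP)) //.
      by rewrite ler_nat.
    case=> k _ /=; rewrite in_itv /= => xin.
    have : 0 < - (p / k.+2%:R) by rewrite -mulNr divr_gt0 ?ltr0n //; lra.
    by move: xin; move: (p / _) => q; lra.
  apply: negligible_bigcup => k; exists `[p + 1 - p / k.+2%:R, 1[%classic.
  split=> //.
  have := main (p - p / k.+2%:R); rewrite -addrA [- _ + 1]addrC addrA; apply.
  have : 0 < - (p / k.+2%:R) by rewrite -mulNr divr_gt0 ?ltr0n //; lra.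
  have : - (p / k.+2%:R) < - p.
    by rewrite -mulNr gtr_pMr ?invf_lt1 ?ltr0n ?ltr1n //; lra.
  by move: (p / _) => q; lra.
by move=> /(negligibleP mu (measurable_itv _)).
Qed.

Hypothesis p_gt : -1 < p.
Hypothesis expanding : forall x, ~ W0_lift F x -> 1 < `|dF x|.

Let a := p + 1.

Lemma circle_map_fixed b : 0 <= b < 1 -> F b = b -> f b = b.
Proof. by move=> b01 Fb; rewrite /circle_map Fb frac1_id. Qed.

Lemma circle_map_p : f p = a.
Proof.
have hp := pin; have hp' := p_gt.
by rewrite /circle_map Fp -(frac1Dz _ 1) frac1_id //; lra.
Qed.

Lemma circle_map_a : f a = a.
Proof. by rewrite /a -[1]/(1%:~R) circle_map_addz circle_map_p. Qed.

(** Otherwise the component, an interval, would contain [p], which [f] sends to the fixed point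
    [a]. *)
Lemma component_gt y : connected_component (basin0_lift F) 0 y -> p < y.
Proof.
have hp := pin; have hp' := p_gt.
move=> Cy; rewrite ltNge; apply/negP => yp.
have /connected_component_sub : connected_component (basin0_lift F) 0 p.
  by apply: component_interval Cy (component0 Cy) _; lra.
apply: (@basin_eventually_fixed 1 p a) => //; first by rewrite /a; lra.
  exact: circle_map_a.
exact: circle_map_p.
Qed.

(** Otherwise let [b] be the first fixed point right of 0. The component of 0 lies between [p] and
    [b], so [b] is outside [W0_lift] and [dF b > 1]; but [y < F y] just left of [b] forces a slope
    of at most 1 there. *)
Lemma no_fixed_point x : 0 < x <= a -> x < F x.
Proof.
have hp := pin; have hp' := p_gt.
move=> xin; rewrite ltNge; apply/negP => Fx.
have [e e0 eP] := lift_gt_near0.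
pose v := Num.min (e / 2) x.
have v0 : 0 < v by rewrite lt_min; lra.
have ve : v <= e / 2 by rewrite ge_min lexx.
have vx : v <= x by rewrite ge_min lexx orbT.
have near0 y : 0 < y <= v -> y < F y.
  move=> yin; apply: eP; first by rewrite gt_eqF; lra.
  by rewrite ltr_norml; lra.
have hc : continuous (fun x => F x - x).
  by move=> y; apply: continuousB; [exact: Fc|exact: cvg_id].
have [||b [bin hb bP]] := @first_zero _ (fun x => F x - x) v x hc vx.
- by have := near0 v ltac:(lra); lra.
- lra.
have Fb : F b = b by lra.
have Flt_b y : 0 < y < b -> y < F y.
  move=> yin; have [yv|vy] := leP y v; first by apply: near0; lra.
  by have := bP y ltac:(lra); lra.
have ha : x <= p + 1 by move: xin; rewrite /a; lra.
have fb : f b = b by apply: circle_map_fixed => //; lra.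
have Cb y : connected_component (basin0_lift F) 0 y -> y < b.
  move=> Cy; rewrite ltNge; apply/negP => yb.
  have /connected_component_sub : connected_component (basin0_lift F) 0 b.
    by apply: component_interval (component0 Cy) Cy _; lra.
  by apply: (@basin_eventually_fixed 0 b b) => //; lra.
have : 1 < `|dF b|.
  (* Translating [b] by [m >= 0] stays right of the component, by [m <= -1] it lands at [p] or
     further left. *)
  apply: expanding => -[m _ /= Cm].
  have := Cb _ Cm; have := component_gt Cm.
  have [m0|m0] := leP 0 m; first by rewrite -(ler0z R) in m0; lra.
  have : (m <= -1)%R by rewrite -(lerD2r 1) addNr lezD1.
  by rewrite -(ler_int R) mulrNz; lra.
rewrite gtr0_norm ?deriv_gt0 // => db.
have [e' e'0 e'P] := continuous_gt_near dFc db.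
pose y := b - Num.min (e' / 2) (b / 2).
have m0 : 0 < Num.min (e' / 2) (b / 2) by rewrite lt_min; lra.
have m1 : Num.min (e' / 2) (b / 2) <= e' / 2 by rewrite ge_min lexx.
have m2 : Num.min (e' / 2) (b / 2) <= b / 2 by rewrite ge_min lexx orbT.
have yb : 0 < y < b by rewrite /y; lra.
have [|z [zin ez]] := @lift_mean_value _ _ _ dFP y b; first lra.
have dz : 1 < dF z by apply: e'P; rewrite ltr_norml; move: zin; rewrite /y; lra.
have := Flt_b y yb.
have : 0 < (dF z - 1) * (b - y) by rewrite mulr_gt0 //; lra.
by lra.
Qed.

(** For lack of fixed points the orbit of [y > 0] under [F] would grow beyond [a]. Then some [z]
    between 0 and [y] is sent exactly to [a], although [z] belongs to the component. *)
Lemma component_le0 y : connected_component (basin0_lift F) 0 y -> y <= 0.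
Proof.
have hp := pin; have hp' := p_gt.
move=> Cy; rewrite leNgt; apply/negP => y0.
have nCa : ~ connected_component (basin0_lift F) 0 a.
  move=> /connected_component_sub.
  apply: (@basin_eventually_fixed 0 a a) => //; first by rewrite /a; lra.
  exact: circle_map_a.
have ya : y < a.
  rewrite ltNge; apply/negP => ay; apply: nCa.
  by apply: component_interval (component0 Cy) Cy _; rewrite /a; move: ay; rewrite /a; lra.
have [bnd|/existsNP[n /negP]] := pselect (forall n, iter n F y <= a).
  have pos n : 0 < iter n F y by elim: n => //= n IH; rewrite -F0 FltE.
  have [|l [yl la Fl]] := @nondecreasing_orbit_fixed _ F y a Fc _ bnd.
    by move=> n; rewrite iterS ltW // no_fixed_point // pos bnd.
  by have := @no_fixed_point l; rewrite Fl ltxx => /(_ ltac:(lra)).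
rewrite -ltNge => an.
have it0 : iter n F 0 = 0 by elim: {an} n => //= n ->.
have [||z zin zE] := @IVT _ (iter n F) 0 y a (ltW y0).
- by apply: continuous_subspaceT; exact: continuous_iter.
- have h : (0 : R) <= iter n F y by move: an; rewrite /a; lra.
  by rewrite it0 (min_idPl h) (max_idPr h); move: an; rewrite /a; lra.
move: zin; rewrite in_itv /= => zin.
(* [iter_circle_map] needs at least one step; with none, [a < y] contradicts [y < a]. *)
case: n an it0 zE => [/= an|n an it0 zE]; first by move: an ya; lra.
have /connected_component_sub : connected_component (basin0_lift F) 0 z.
  by apply: component_interval (component0 Cy) Cy _.
apply: (@basin_eventually_fixed n.+1 z a); rewrite ?circle_map_a //.
  by rewrite /a; lra.
by rewrite iter_circle_map zE frac1_id // /a; lra.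
Qed.

(** No integer translate of [x] meets the component, which lies right of [p] and not beyond 0. *)
Lemma deriv_gt1 x : 0 < x <= a -> 1 < dF x.
Proof.
have hp := pin; have hp' := p_gt.
move=> xin; suff : 1 < `|dF x| by rewrite gtr0_norm ?deriv_gt0.
apply: expanding => -[m _ /= Cm].
have := component_le0 Cm; have := component_gt Cm.
have [m0|m0] := leP 0 m; first by rewrite -(ler0z R) in m0; lra.
have : (m <= -1)%R by rewrite -(lerD2r 1) addNr lezD1.
by rewrite -(ler_int R) mulrNz; move: xin; rewrite /a; lra.
Qed.

End FixedPoint.

Lemma saddle_node_dirac (mu : probability R R) :
  (forall x, ~ W0_lift F x -> 1 < `|dF x|) ->
  mu [set x | 0 <= x < 1] = 1%E ->
  (forall A, measurable A -> mu (f @^-1` A) = mu A) ->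
  KS_entropy mu f = (\int[mu]_x (ln `|dF x|)%:E)%E -> mu [set 0] = 1%E.
Proof.
move=> expd mu1 inv KS.
have [p [pin Fp F_gt]] := last_fixed_point.
have null := left_basin_null pin Fp F_gt inv.
have mu0p : mu [set x | 0 <= x <= p + 1] = 1%E.
  have mA : measurable [set x | 0 <= x <= p + 1] by rewrite -set_itvcc.
  have mB : measurable [set x : R | 0 <= x < 1] by rewrite -set_itvco.
  apply/eqP; rewrite eq_le probability_le1 //= -mu1.
  rewrite -[leRHS]adde0 -null; apply: le_trans (measureU2 _ _ _) => //.
  apply: le_measure; rewrite ?inE //; first exact: measurableU.
  move=> x /= xin; have [xp|px] := leP x (p + 1); [left|right]; rewrite /= ?in_itv /=; lra.
(* For [p = -1] the carrier [0, p + 1] is the single point 0. *)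
have [pN1|pN1] := eqVneq p (-1).
  move: mu0p; rewrite pN1 addNr.
  rewrite (_ : [set x | 0 <= x <= 0] = [set 0]) //.
  by apply/seteqP; split=> x /=; [move=> h; apply/eqP; rewrite eq_le andbC|move=> ->; rewrite lexx].
have {pN1}p_gt : -1 < p by rewrite lt_neqAle eq_sym pN1; case/andP: pin.
have [c0 [del [c00 del0 cusp]]] := deriv_cusp.
have [|L L0 LP] := @ln_deriv_lipschitz (p + 1); first lra.
have dgt1 := deriv_gt1 pin Fp p_gt expd.
have [d d0 dE] := degree_nat.
have Fa : F (p + 1) = p + 1 + d.-1%:R.
  rewrite per Fp dE -pmulrn -[in LHS](prednK d0) -natr1; ring.
(* [a < F a] excludes degree 1. *)
have d1 : (1 < d)%N.
  have := no_fixed_point pin Fp p_gt expd (x := p + 1).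
  rewrite Fa ltrDl ltr0n => h; have := h ltac:(lra).
  by rewrite -subn1 subn_gt0.
apply: (repeller_entropy_dirac dFP dFc deriv_gt0 _ d1 F0 Fa dgt1 L0 LP c00 del0 cusp
  dF0 mu0p inv KS).
lra.
Qed.

End SaddleNode.

(** * Reduction to a lift fixing 0 *)

Theorem theoremB (R : realType) (F : R -> R) (deg : int) (mu : probability R R) :
                
  (forall x, derivable F x 1) ->
  (forall x, derivable (derive1 F) x 1) ->
  continuous (derive1n 2 F) ->
                                                   
  (forall x, F (x + 1) = F x + deg%:~R) ->
                                    
  (forall x, derive1 F x != 0) ->
                                      
  circle_map F 0 = 0 ->
  derive1 F 0 = 1 ->
  0 < derive1n 2 F 0 ->
                                               
  (forall x, 0 <= x < 1 -> circle_map F x = x -> derive1 F x = 1 ->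
     0 < derive1n 2 F x -> x = 0) ->
                            
  (forall x, ~ W0_lift F x -> 1 < `|derive1 F x|) ->
                                                                  
  mu [set x : R | 0 <= x < 1] = 1%E ->
                          
  (forall A, measurable A -> mu (circle_map F @^-1` A) = mu A) ->
                       
  KS_entropy mu (circle_map F) = (\int[mu]_x (ln `|derive1 F x|)%:E)%E ->
  forall A, measurable A -> mu A = \d_(0 : R) A.
Proof.
move=> F1 F2 F2c per dF_neq0 f0 dF0 ddF0 _ expd mu1 inv KS.
(* [F 0] is an integer because the circle map fixes 0; subtracting it changes neither the circle map
   nor the derivatives. *)
pose Fn x := F x - F 0.
have FnE x : Fn x = F x + (- Num.floor (F 0))%:~R.
  have F0E : F 0 = (Num.floor (F 0))%:~R by apply/eqP; rewrite -subr_eq0; apply/eqP.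
  by rewrite /Fn F0E intrKfloor mulrNz.
have cE : circle_map Fn = circle_map F.
  by apply/funext => x; rewrite /circle_map FnE frac1Dz.
have dFP x : is_derive x (1 : R) F (derive1 F x).
  by rewrite derive1E; exact/derivableP/F1.
have ddFP x : is_derive x (1 : R) (derive1 F) (derive1n 2 F x).
  by rewrite /derive1n /= derive1E; exact/derivableP/F2.
have dFnP x : is_derive x (1 : R) Fn (derive1 F x).
  by have := dFP x => ?; rewrite /Fn; apply: is_derive_eq; rewrite subr0.
apply: probability_dirac.
apply: (@saddle_node_dirac R Fn (derive1 F) (derive1n 2 F) deg) => //.
- by move=> x; rewrite /Fn per addrAC.
- by rewrite /Fn subrr.
- by move=> x; rewrite /W0_lift /basin0_lift cE; exact: expd.
- by rewrite cE.
- by rewrite cE.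
Qed.
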